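(* There is an algorithm $\mathcal{B}$ that, given a scoring vector $\vec\alpha=(\alpha_1,\dots,\alpha_m)$ and an instance $I=(C,V,\Pi,p)$ of $\mathcal{R}_{\vec\alpha}$-shift-bribery with $|C|=m$, outputs a successful shift-action $\mathbf{t}$ for $I$ that satisfies $\Pi(\mathbf{t})\le 2\,\mathrm{opt}(I)$, and runs in time $\mathrm{poly}(|I|,|\vec\alpha|)$.
   Context: $\mathbb{Z}^+$ denotes the set of all nonnegative integers. An election is a pair $E=(C,V)$ with $C$ a set of $m$ candidates and $V=(v^1,\dots,v^n)$ a list of voters, each voter $v^i$ being a strict linear order $\succ^i$ over $C$. A voting rule $\mathcal{R}$ maps each election to a set of winners $W\subseteq C$ (ties allowed; $p$ ''is a winner'' means $p\in W$). Scoring rule $\mathcal{R}_{\vec\alpha}$: $\vec\alpha=(\alpha_1,\dots,\alpha_m)$ with $\alpha_j\in\mathbb{Z}^+$ for all $j$ and $\alpha_1\ge\dots\ge\alpha_m$. Each candidate receives $\alpha_j$ points from each voter ranking it in position $j$ (position 1 is the top); the winners are all candidates with the maximum total score. $\mathcal{R}$-shift-bribery: an instance is $I=(C,V,\Pi,p)$ where $C=\{p,c_1,\dots,c_{m-1}\}$, $V=(v^1,\dots,v^n)$ is a list of linear orders over $C$, $p\in C$ is the designated candidate, and $\Pi=(\pi^1,\dots,\pi^n)$ is a list of cost functions $\pi^i:\mathbb{Z}^+\to\mathbb{Z}^+$ with $\pi^i(0)=0$, $\pi^i(k)\le\pi^i(k+1)$ for all $k$, and $\pi^i(s)=\pi^i(t-1)$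 for all $s\ge t$, where $t$ is the position of $p$ in $\succ^i$ (so $\pi^i$ is specified by its values at $1,\dots,t-1$). A shift-action is $\mathbf{t}=(t_1,\dots,t_n)\in(\mathbb{Z}^+)^n$; its cost is $\Pi(\mathbf{t})=\sum_{i=1}^n\pi^i(t_i)$. The election $\mathrm{shf}(C,V,\mathbf{t})$ is obtained from $(C,V)$ by moving $p$ upwards by $t_i$ positions in the $i$-th vote for each $i$ (or to the top if fewer than $t_i$ candidates are above $p$), leaving the relative order of the other candidates unchanged. The shift-action $\mathbf{t}$ is successful for $I$ if $p$ is an $\mathcal{R}$-winner of $\mathrm{shf}(C,V,\mathbf{t})$. $\mathrm{opt}(I)$ is the minimum of $\Pi(\mathbf{t})$ over successful shift-actions $\mathbf{t}$. $|I|$ is the representation size of $I$ with all entries of $\Pi$ written in binary; $|\vec\alpha|$ is the number of bits in the binary encoding of $\vec\alpha$. *)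

(* Defs.v *)
From HB Require Import structures.
From mathcomp Require Import all_boot.
From mathcomp Require Import boolp.

Set Implicit Arguments.
Unset Strict Implicit.
Unset Printing Implicit Defensive.

(* The m candidates are the elements of 'I_m; a strict linear order
   over them is the list of all candidates, from the most preferred one to the
   least preferred one. *)

Record vote (m : nat) := Vote {
  ranking :> seq 'I_m;
  rankingP : perm_eq ranking (enum 'I_m) }.

(* Positions are counted from 0, so the top position is 0. *)
Definition pos m (v : vote m) (c : 'I_m) : nat := index c v.

Definition voting_rule (m : nat) :=
  forall n : nat, n.-tuple (vote m) -> {set 'I_m}.

Record scoring_vector (m : nat) := ScoringVector {
  points :> m.-tuple nat;
  points_sorted : sorted geq points }.

Definition score m (alpha : scoring_vector m) n (V : n.-tuple (vote m))
    (c : 'I_m) : nat :=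
  \sum_(i < n) nth 0 alpha (pos (tnth V i) c).

Definition scoring_rule m (alpha : scoring_vector m) : voting_rule m :=
  fun n V => [set c | [forall d, score alpha V d <= score alpha V c]].

(* Truncated subtraction sends p to the top when fewer than k candidates are
   above it. *)
Definition shift_seq (T : eqType) (p : T) (k : nat) (s : seq T) : seq T :=
  let j := index p s - k in
  take j (rem p s) ++ p :: drop j (rem p s).

Lemma perm_shift_seq (T : eqType) (p : T) k (s : seq T) :
  p \in s -> perm_eq (shift_seq p k s) s.
Proof.
move=> ps; rewrite /shift_seq -cat1s perm_catCA /= cat_take_drop perm_sym.
exact: perm_to_rem.
Qed.

Lemma shift_vote_subproof m (p : 'I_m) k (v : vote m) :
  perm_eq (shift_seq p k v) (enum 'I_m).
Proof.
apply: perm_trans (rankingP v); apply: perm_shift_seq.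
by rewrite (perm_mem (rankingP v)) mem_enum.
Qed.

Definition shift_vote m (p : 'I_m) (k : nat) (v : vote m) : vote m :=
  Vote (shift_vote_subproof p k v).

Record instance (m n : nat) := Instance {
  votes : n.-tuple (vote m);
  designated : 'I_m;
  price : 'I_n -> nat -> nat;
  price0 : forall i, price i 0 = 0;
  price_le : forall i k, price i k <= price i k.+1;
  price_const : forall i s, pos (tnth votes i) designated < s ->
    price i s = price i (pos (tnth votes i) designated) }.

Definition shift_action (n : nat) := n.-tuple nat.

Definition shift_cost m n (I : instance m n) (t : shift_action n) : nat :=
  \sum_(i < n) price I i (tnth t i).

Definition shf m n (p : 'I_m) (V : n.-tuple (vote m)) (t : shift_action n) :
    n.-tuple (vote m) :=
  [tuple shift_vote p (tnth t i) (tnth V i) | i < n].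

Definition successful m n (R : voting_rule m) (I : instance m n)
    (t : shift_action n) : Prop :=
  designated I \in R n (shf (designated I) (votes I) t).

Definition successful_cost m n (R : voting_rule m) (I : instance m n)
    (k : nat) : Prop :=
  exists t, successful R I t /\ shift_cost I t = k.

(* The minimal cost of a successful shift-action; the value 0 is a dummy, used
   only when there is no successful shift-action. *)
Definition opt m n (R : voting_rule m) (I : instance m n) : nat :=
  if pselect (exists k, `[< successful_cost R I k >]) is left ex
  then ex_minn ex else 0.

(* A cost function is given by its values at
   1, ..., pos v p, which determine it. *)

Definition bits (k : nat) : nat := (trunc_log 2 k).+1.

Definition bitsize (s : seq nat) : nat := \sum_(k <- s) bits k.

Definition encode_scoring m (alpha : scoring_vector m) : seq nat := alpha.

Definition encode_instance m n (I : instance m n) : seq nat :=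
  [:: m, n, val (designated I) &
      flatten [seq map val (ranking (tnth (votes I) i)) | i : 'I_n]
   ++ flatten [seq [seq price I i k |
                    k <- iota 1 (pos (tnth (votes I) i) (designated I))]
              | i : 'I_n]].

(* Model of computation: the random access machine with logarithmic cost of
   Aho, Hopcroft and Ullman, with structured control flow. A cell holds an
   arbitrary natural number, and evaluating an expression costs the number of
   bits of every value that occurs in it, addresses included; hence time on
   this machine and time on a Turing machine are polynomially related. The
   memory is split into arrays with statically known names; a program uses
   finitely many of them, so they can be interleaved in one linear memory. *)

Inductive binop := Add | Sub | Mul | Div.

Definition binop_fun (o : binop) : nat -> nat -> nat :=
  match o with Add => addn | Sub => subn | Mul => muln | Div => divn end.

Inductive expr :=
  | Const of nat
  | Get of nat & expr          (* array name, address *)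
  | Op of binop & expr & expr.

Inductive cmd :=
  | Skip
  | Set_ of nat & expr & expr  (* array name, address, new value *)
  | Seq of cmd & cmd
  | If of expr & cmd & cmd     (* nonzero is true *)
  | While of expr & cmd.

Definition state := nat -> nat -> nat.

Definition update (st : state) (a i x : nat) : state :=
  fun b j => if (b == a) && (j == i) then x else st b j.

Fixpoint eval (st : state) (e : expr) : nat :=
  match e with
  | Const k => k
  | Get a e1 => st a (eval st e1)
  | Op o e1 e2 => binop_fun o (eval st e1) (eval st e2)
  end.

Fixpoint eval_time (st : state) (e : expr) : nat :=
  bits (eval st e) +
  match e with
  | Const _ => 0
  | Get _ e1 => eval_time st e1
  | Op _ e1 e2 => eval_time st e1 + eval_time st e2
  end.

(* exec c st st' T: from st, the program c halts in state st' after time T. *)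
Inductive exec : cmd -> state -> state -> nat -> Prop :=
  | exec_skip st : exec Skip st st 1
  | exec_set a e1 e2 st :
      exec (Set_ a e1 e2) st (update st a (eval st e1) (eval st e2))
           (eval_time st e1 + eval_time st e2)
  | exec_seq c1 c2 st st1 st2 T1 T2 :
      exec c1 st st1 T1 -> exec c2 st1 st2 T2 ->
      exec (Seq c1 c2) st st2 (T1 + T2)
  | exec_if_true e c1 c2 st st1 T :
      eval st e != 0 -> exec c1 st st1 T ->
      exec (If e c1 c2) st st1 (eval_time st e + T)
  | exec_if_false e c1 c2 st st1 T :
      eval st e = 0 -> exec c2 st st1 T ->
      exec (If e c1 c2) st st1 (eval_time st e + T)
  | exec_while_true e c st st1 st2 T1 T2 :
      eval st e != 0 -> exec c st st1 T1 -> exec (While e c) st1 st2 T2 ->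
      exec (While e c) st st2 (eval_time st e + T1 + T2)
  | exec_while_false e c st :
      eval st e = 0 -> exec (While e c) st st (eval_time st e).

(* The inputs are in the arrays 0, 1, ...; every other cell contains 0. *)
Definition initial_state (inputs : seq (seq nat)) : state :=
  fun a i => nth 0 (nth [::] inputs a) i.

Definition read_array (st : state) (a n : nat) : n.-tuple nat :=
  [tuple st a i | i < n].

(* Main.v *)
Require Import Defs.
From mathcomp Require Import all_boot zify boolp.

(* Write G(t) for the points that the designated candidate p has after the
   shift-action t. Moving p further up in a vote costs another candidate at most
   what p gains. Hence, if t is successful and s is not, then
   G(s) + G(min(s, t)) < 2 G(t).

   Guess a voter who gets the most expensive shift in an optimal t, and that
   shift; let b be its price. Start from this single shift and, as long as p
   loses, perform the extension with the smallest ratio of added cost to gained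
   points among those that keep every price at most b. There is then always a
   multiplier for which each vote of the current s minimises cost minus weighted
   points; comparing s with min(s, t) and with max(s, t), the inequality above
   yields cost(s) + cost(min(s, t)) <= 2 cost(t) for every losing s. As
   min(s, t) contains the guessed shift, its cost is at least b, while the last
   extension adds at most b; so the first successful s costs at most 2 cost(t).
   The best result over all guesses is returned.

   The machine program consists of loops over voters and candidates in which no
   product is ever stored, so that each step adds a bounded number of bits to
   the largest cell; this bounds the running time whatever is computed. *)

Set Implicit Arguments.
Unset Strict Implicit.
Unset Printing Implicit Defensive.

(** * Structured programs and their running time *)

(* [PFor x b p] runs p with cell 0 of the array x going through the numbers
   below the value of cell b of array 1. *)
Inductive prog :=
  | PSkip
  | PSet of nat & expr & expr
  | PSeq of prog & prog
  | PIf of expr & prog & prog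
  | PFor of nat & nat & prog.

Definition incr x := Set_ x (Const 0) (Op Add (Get x (Const 0)) (Const 1)).

Definition guard x b := Op Defs.Sub (Get 1 (Const b)) (Get x (Const 0)).

Fixpoint compile (p : prog) : cmd :=
  match p with
  | PSkip => Skip
  | PSet a i e => Set_ a i e
  | PSeq p q => Seq (compile p) (compile q)
  | PIf e p q => If e (compile p) (compile q)
  | PFor x b p => Seq (Set_ x (Const 0) (Const 0))
                      (While (guard x b) (Seq (compile p) (incr x)))
  end.

(** The number of rounds is read once, on entry. This agrees with the compiled loop, which tests its
    guard anew each round, because [wf] protects both the bound and the counter. *)
Fixpoint run (p : prog) (st : state) : state :=
  match p with
  | PSkip => st
  | PSet a i e => update st a (eval st i) (eval st e)
  | PSeq p q => run q (run p st)
  | PIf e p q => if eval st e != 0 then run p st else run q st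
  | PFor x b p =>
      iter (st 1 b) (fun s => let s' := run p s in update s' x 0 (s' x 0).+1)
           (update st x 0 0)
  end.

Fixpoint writes (p : prog) : seq nat :=
  match p with
  | PSkip => [::]
  | PSet a _ _ => [:: a]
  | PSeq p q | PIf _ p q => writes p ++ writes q
  | PFor x _ p => x :: writes p
  end.

Fixpoint mul_free (e : expr) : bool :=
  match e with
  | Const _ | Get _ _ => true
  | Op Mul _ _ => false
  | Op _ e1 e2 => mul_free e1 && mul_free e2
  end.

(* Addresses and tests may contain products, stored values may not: hence a
   single assignment adds only a bounded number of bits to the largest cell. *)
Fixpoint wf (p : prog) : bool :=
  match p with
  | PSkip => true
  | PSet a _ e => (1 < a) && mul_free e
  | PSeq p q | PIf _ p q => wf p && wf q
  | PFor x b p => [&& 1 < x, b < 2, x \notin writes p & wf p]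
  end.

Lemma run_frame p st a : a \notin writes p -> run p st a = st a.
Proof.
elim: p st => [|b i e|p IHp q IHq|e p IHp q IHq|x b p IHp] st //=.
- by rewrite inE /update => /negbTE ->.
- by rewrite mem_cat negb_or => /andP[ap aq]; rewrite IHq // IHp.
- by rewrite mem_cat negb_or => /andP[ap aq]; case: ifP => _; [apply: IHp|apply: IHq].
rewrite inE negb_or => /andP[/negbTE ax ap].
by elim: (st 1 b) => [|k IHk]; rewrite /= /update ax //= IHp.
Qed.

(** Arrays 0 and 1 hold the input, so loop bounds stay constant during a run. *)
Lemma wf_writes p a : wf p -> a < 2 -> a \notin writes p.
Proof.
elim: p => [|b i e|p IHp q IHq|e p IHp q IHq|x b p IHp] //=.
- by rewrite inE => /andP[b1 _] a2; lia.
- by move=> /andP[wp wq] a2; rewrite mem_cat negb_or IHp // IHq.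
- by move=> /andP[wp wq] a2; rewrite mem_cat negb_or IHp // IHq.
by case/and4P=> x1 _ _ wp a2; rewrite inE negb_or IHp // andbT; lia.
Qed.

(* For a concrete invariant that does not read the array x, the updates of x
   disappear by conversion. *)
Lemma for_rule (I : nat -> state -> Prop) x b p st N :
  wf (PFor x b p) -> st 1 b = N -> I 0 (update st x 0 0) ->
  (forall k st', k < N -> st' x 0 = k ->
     (forall a, a \notin writes (PFor x b p) -> st' a = st a) ->
     I k st' -> I k.+1 (update (run p st') x 0 k.+1)) ->
  I N (run (PFor x b p) st).
Proof.
move=> wfp <- I0 IS /=; have [_ _ xp _] := and4P wfp.
suff: forall k, k <= st 1 b ->
  let st' := iter k (fun s => let s' := run p s in update s' x 0 (s' x 0).+1)
                  (update st x 0 0) in st' x 0 = k /\ I k st'.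
  by case/(_ _ (leqnn _)).
elim=> [_|k IHk ltk] /=; first by rewrite /update !eqxx.
case: (IHk (ltnW ltk)) => stx Ik.
split; first by rewrite {1}/update !eqxx /= run_frame // stx.
rewrite [in X in update _ _ _ X]run_frame // stx.
apply: IS => // a; rewrite /= inE negb_or => /andP[/negbTE ax ap].
elim: k {IHk ltk stx Ik} => [|k IHk] /=; first by rewrite /update ax.
by rewrite /update ax /= run_frame.
Qed.

(** * Bit growth and running time *)

Fixpoint esize (e : expr) : nat :=
  match e with
  | Const k => k.+1
  | Get _ e1 => (esize e1).+1
  | Op _ e1 e2 => (esize e1 + esize e2).+1
  end.

Definition bounded (B : nat) (st : state) := forall a i, st a i < 2 ^ B.

Lemma bits_le k B : k < 2 ^ B -> bits k <= B.+1.
Proof.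
move=> kB; rewrite /bits ltnS; case: k kB => [|k] kB; first by rewrite trunc_log0.
by rewrite -(leq_exp2l (m := 2)) // (leq_trans (trunc_logP _ _)) // ltnW.
Qed.

Lemma ltn_bits k : k < 2 ^ bits k.
Proof. exact: trunc_log_ltn. Qed.

Lemma ltn_add_exp2 x y a b : x < 2 ^ a -> y < 2 ^ b -> x + y < 2 ^ (a + b).+1.
Proof.
move=> xa yb; rewrite expnS expnD.
have := expn_gt0 2 a; have := expn_gt0 2 b; nia.
Qed.

Lemma ltn_mul_exp2 x y a b : x < 2 ^ a -> y < 2 ^ b -> x * y < 2 ^ (a + b).
Proof. by move=> xa yb; rewrite expnD ltn_mul. Qed.

Lemma eval_bound st B e : bounded B st -> eval st e < 2 ^ (B.+1 * esize e).
Proof.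
move=> stB; elim: e => [k|a e IHe|o e1 IH1 e2 IH2] /=.
- apply: leq_trans (ltn_expl k (isT : 1 < 2)) _.
  by rewrite leq_exp2l //; nia.
- by apply: leq_trans (stB _ _) _; rewrite leq_exp2l //; nia.
set a1 := B.+1 * _ in IH1; set a2 := B.+1 * _ in IH2.
have E : (a1 + a2).+1 <= B.+1 * (esize e1 + esize e2).+1 by rewrite /a1 /a2; nia.
case: o => /=; apply: leq_trans (_ : _ <= 2 ^ (a1 + a2).+1) _; rewrite ?leq_exp2l //.
- exact: ltn_add_exp2.
- by apply: (leq_ltn_trans (leq_subr _ _)) (leq_trans IH1 _); rewrite leq_exp2l //; lia.
- by apply: (leq_trans (ltn_mul_exp2 IH1 IH2)); rewrite leq_exp2l.
by apply: (leq_ltn_trans (leq_div _ _)) (leq_trans IH1 _); rewrite leq_exp2l //; lia.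
Qed.

(** Without products a node adds at most one bit to its larger operand, so the size of the
    expression is added to [B] instead of multiplying it. *)
Lemma eval_bound_mul_free st B e :
  mul_free e -> bounded B st -> eval st e < 2 ^ (B + esize e).
Proof.
move=> lin stB; elim: e lin => [k|a e IHe|o e1 IH1 e2 IH2] /= lin.
- apply: leq_trans (ltn_expl k (isT : 1 < 2)) _.
  by rewrite leq_exp2l //; lia.
- by apply: leq_trans (stB _ _) _; rewrite leq_exp2l //; lia.
have {IH1 IH2}[IH1 IH2] : eval st e1 < 2 ^ (B + esize e1) /\
                 eval st e2 < 2 ^ (B + esize e2).
  by case: o lin => // /andP[l1 l2]; split; auto.
have M : forall e', esize e' <= (esize e1 + esize e2) ->
   2 * 2 ^ (B + esize e') <= 2 ^ (B + (esize e1 + esize e2).+1).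
  by move=> e' le; rewrite -expnS leq_exp2l //; lia.
have [M1 M2] := (M e1 (leq_addr _ _), M e2 (leq_addl _ _)).
case: o lin => //= _; first lia.
  by have := leq_subr (eval st e2) (eval st e1); lia.
by have := leq_div (eval st e1) (eval st e2); lia.
Qed.

Lemma eval_time_bound st B e :
  bounded B st -> eval_time st e <= B.+2 * (esize e) ^ 2.
Proof.
move=> stB; elim: e => [k|a e IHe|o e1 IH1 e2 IH2] /=;
  [have := eval_bound (Const k) stB|have := eval_bound (Get a e) stB
  |have := eval_bound (Op o e1 e2) stB]; move/bits_le => /=; nia.
Qed.

(* If all loop bounds are at most N and all cells have at most B bits, then a
   run of p adds at most w = [weight N p] bits to the largest cell and takes time
   at most w * (B + w). The constants of a loop cover its guard and its counter. *)
Fixpoint weight (N : nat) (p : prog) : nat :=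
  match p with
  | PSkip => 1
  | PSet _ i e => 2 * (esize i ^ 2 + esize e ^ 2)
  | PSeq p q => weight N p + weight N q
  | PIf e p q => 2 * esize e ^ 2 + (weight N p + weight N q)
  | PFor x b p => 200 + N * (100 + weight N p)
  end.

Lemma boundedW B B' st : B <= B' -> bounded B st -> bounded B' st.
Proof. by move=> le stB a i; apply: leq_trans (stB a i) _; rewrite leq_exp2l. Qed.

Lemma bounded_update B B' st a i x :
  B <= B' -> x < 2 ^ B' -> bounded B st -> bounded B' (update st a i x).
Proof.
move=> le xB stB b j; rewrite /update; case: ifP => // _.
exact: boundedW le stB b j.
Qed.

Lemma weight_gt0 N p : 0 < weight N p.
Proof.
have E e : 0 < esize e by case: e.
elim: p => [|a i e|p IHp q IHq|e p IHp q IHq|x b p IHp] //=; try lia.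
by have := E e; nia.
Qed.

Lemma exec_compile N p st B :
  wf p -> st 1 0 <= N -> st 1 1 <= N -> bounded B st ->
  bounded (B + weight N p) (run p st) /\
  exists2 T, exec (compile p) st (run p st) T
           & T <= weight N p * (B + weight N p).
Proof.
elim: p st B => [|a i e|p IHp q IHq|e p IHp q IHq|x b p IHp] st B /=.
- move=> _ _ _ stB; split; first by apply: boundedW stB; lia.
  by exists 1; [exact: exec_skip|lia].
- move=> /andP[_ lin] _ _ stB.
  have := eval_time_bound i stB; have := eval_time_bound e stB => Te Ti.
  have := eval_bound_mul_free lin stB => eB.
  have e0 : 0 < esize e by case: (e).
  split.
    by apply: bounded_update stB; [lia|apply: leq_trans eB _; rewrite leq_exp2l //; nia].
  exists (eval_time st i + eval_time st e); first exact: exec_set.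
  set w := (_ + _ ^ 2); have : B.+2 * w <= 2 * w * (B + 2 * w) by nia.
  by apply: leq_trans; rewrite /w mulnDr; lia.
- move=> /andP[wp wq] st0 st1 stB.
  have [stpB [T1 ex1 T1le]] := IHp _ _ wp st0 st1 stB.
  have F : run p st 1 = st 1 by rewrite run_frame // wf_writes.
  have [|||stqB [T2 ex2 T2le]] := IHq (run p st) (B + weight N p) wq; rewrite ?F //.
  split; first by apply: boundedW stqB; lia.
  exists (T1 + T2); first exact: exec_seq ex1 ex2.
  have := weight_gt0 N p; have := weight_gt0 N q; nia.
- move=> /andP[wp wq] st0 st1 stB; have Te := eval_time_bound e stB.
  have [stpB [T1 ex1 T1le]] := IHp _ _ wp st0 st1 stB.
  have [stqB [T2 ex2 T2le]] := IHq _ _ wq st0 st1 stB.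
  have wp0 := weight_gt0 N p; have wq0 := weight_gt0 N q.
  case: ifP => [e0|/negbFE/eqP e0]; split.
  + by apply: boundedW stpB; lia.
  + exists (eval_time st e + T1); first exact: exec_if_true.
    by apply: leq_trans (leq_add Te T1le) _; move: (_ ^ 2) => w; nia.
  + by apply: boundedW stqB; lia.
  exists (eval_time st e + T2); first exact: exec_if_false.
  by apply: leq_trans (leq_add Te T2le) _; move: (_ ^ 2) => w; nia.
case/and4P=> x1 b2 xp wp st0 st1 stB.
set w := 100 + weight N p.
have xE : (1 == x) = false by lia.
have stb : st 1 b <= N by case: b b2 => [|[|]].
(* Induction on the number [k] of remaining rounds, for an arbitrary current bit bound [C]. *)
have loop k : forall s C, s 1 = st 1 -> s x 0 + k = st 1 b -> bounded C s ->
    let s' := iter k (fun s => let s' := run p s in update s' x 0 (s' x 0).+1) s in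
    bounded (C + k * w) s' /\
    exists2 T, exec (While (guard x b) (Seq (compile p) (incr x))) s s' T
             & T <= (100 + k * w) * (C + k * w + 1).
  elim: k => [|k IHk] s C s1 sx sC.
    have Tg := eval_time_bound (guard x b) sC.
    rewrite /= mul0n !addn0; split => //; exists (eval_time s (guard x b)).
      by apply: exec_while_false; rewrite /= s1; lia.
    by apply: leq_trans Tg _; rewrite /= ; nia.
  have [|||rB [T1 ex1 T1le]] := IHp s C wp; rewrite ?s1 //.
  have rx : run p s x = s x by rewrite run_frame.
  have r1 : run p s 1 = s 1 by rewrite run_frame ?wf_writes.
  have bI := eval_bound_mul_free (e := Op Add (Get x (Const 0)) (Const 1)) isT rB.
  have uB : bounded (C + w) (update (run p s) x 0 (run p s x 0).+1).
    apply: (bounded_update (B := C + weight N p)) rB; first by rewrite /w; lia.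
    rewrite /= addn1 in bI; apply: leq_trans bI _.
    by rewrite leq_exp2l // /w  /=; lia.
  have [||s'B [T2 ex2 T2le]] := IHk _ _ _ _ uB.
  - by rewrite /update xE r1.
  - by rewrite {1}/update !eqxx /= rx; lia.
  rewrite iterSr /=; split; first by apply: boundedW s'B; lia.
  have Tg := eval_time_bound (guard x b) sC.
  have TI := eval_time_bound (Op Add (Get x (Const 0)) (Const 1)) rB.
  have T0 := eval_time_bound (Const 0) rB.
  exists (eval_time s (guard x b) + (T1 + (eval_time (run p s) (Const 0) +
     eval_time (run p s) (Op Add (Get x (Const 0)) (Const 1)))) + T2).
    apply: exec_while_true; [|apply: exec_seq ex1 _|exact: ex2].
      by rewrite /= s1; lia.
    have -> : (run p s x 0).+1 = eval (run p s) (Op Add (Get x (Const 0)) (Const 1)).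
      by rewrite /= addn1.
    exact: exec_set.
  have bits01 : bits 0 = 1 by rewrite /bits trunc_log0.
  have {}Tg : eval_time s (guard x b) <= 36 * C.+2.
    by apply: leq_trans Tg _; rewrite mulnC leq_mul2r; apply/orP; right; rewrite /=; nia.
  have {}T0 : eval_time (run p s) (Const 0) <= (C + weight N p).+2 by rewrite muln1 in T0.
  have {}TI : eval_time (run p s) (Op Add (Get x (Const 0)) (Const 1))
              <= 25 * (C + weight N p).+2 by rewrite mulnC.
  apply: leq_trans (leq_add (leq_add Tg (leq_add T1le (leq_add T0 TI))) T2le) _.
  (* It remains to see that a single round costs at most [w * Y]. *)
  set Y := C + w + k * w + 1.
  have -> : C + k.+1 * w + 1 = Y by rewrite mulSn /Y; lia.
  have -> : 100 + k.+1 * w = w + (100 + k * w) by rewrite mulSn; lia.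
  rewrite [leqRHS]mulnDl leq_add2r.
  have le : C + weight N p + 101 <= Y by rewrite /Y /w; lia.
  by apply: leq_trans (leq_mul (leqnn w) le); rewrite /w; nia.
have Bst : bounded B (update st x 0 0).
  by apply: bounded_update stB => //; rewrite expn_gt0.
have [||s'B [T ex Tle]] := loop (st 1 b) _ _ _ _ Bst.
- by rewrite /update xE.
- by rewrite {1}/update !eqxx.
have kw : st 1 b * w <= N * w by rewrite leq_mul2r stb orbT.
split; first by apply: boundedW s'B; lia.
exists (eval_time st (Const 0) + eval_time st (Const 0) + T).
  apply: exec_seq ex.
  by have := exec_set x (Const 0) (Const 0) st.
apply: leq_trans (_ : _ <= 4 + (100 + N * w) * (B + N * w + 1)) _.
  apply: leq_add; first by rewrite /= /bits trunc_log0.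
  by apply: leq_trans Tle _; apply: leq_mul; lia.
move: (N * w) => v; nia.
Qed.

(** The program is fixed: each enclosing loop raises the degree by one. *)
Lemma weight_poly p : exists C D, forall N, weight N p <= C * N.+1 ^ D.
Proof.
elim: p => [|a i e|p [C1 [D1 h1]] q [C2 [D2 h2]]|e p [C1 [D1 h1]] q [C2 [D2 h2]]
           |x b p [C [D h]]] /=.
- by exists 1, 0 => N; rewrite expn0.
- by exists (2 * (esize i ^ 2 + esize e ^ 2)), 0 => N; rewrite expn0 muln1.
- exists (C1 + C2), (D1 + D2) => N; apply: leq_trans (leq_add (h1 N) (h2 N)) _.
  by rewrite mulnDl leq_add // leq_mul2l leq_pexp2l ?orbT //; lia.
- exists (2 * esize e ^ 2 + (C1 + C2)), (D1 + D2) => N.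
  have N0 : 0 < N.+1 ^ (D1 + D2) by rewrite expn_gt0.
  rewrite mulnDl leq_add //; first by rewrite leq_pmulr.
  apply: leq_trans (leq_add (h1 N) (h2 N)) _.
  by rewrite mulnDl leq_add // leq_mul2l leq_pexp2l ?orbT //; lia.
exists (300 + C), D.+1 => N; have := h N; rewrite expnS.
have : 0 < N.+1 ^ D by rewrite expn_gt0.
by move: (_ ^ _) (weight _ _) => y z; nia.
Qed.

(** * The greedy algorithm *)

(* The position, after a shift by k, of the candidate in position j of a vote
   that has the shifted candidate in position P. *)
Definition npos (P k j : nat) : nat :=
  if j < P - k then j else if j < P then j.+1 else if P < j then j else P - k.

Lemma npos_self P k : npos P k P = P - k.
Proof. by rewrite /npos ltnn; case: ifP => //; lia. Qed.

Lemma nposW P k j : npos P k j = npos P (minn k P) j.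
Proof. by rewrite /npos; have -> : P - minn k P = P - k by lia. Qed.

Lemma ltn_sum_const n m (s : nat -> nat) : 0 < n -> (forall i, i < n -> s i < m) ->
  \sum_(i < n) s i < n * m.
Proof.
move=> n0 sm; have : \sum_(i < n) (s i + 1) <= \sum_(i < n) m.
  by apply: leq_sum => i _; rewrite addn1 sm.
by rewrite big_split /= sum1_card sum_nat_const card_ord; lia.
Qed.

(** If paying [x'] for [y'] points is preferred to paying less, [x], for [y] points when a point is
    worth [a0 / w0], it still is when a point is worth [a / w], which is no less. Ratios are
    cross-multiplied. *)
Lemma price_increase x x' y y' w w0 a a0 :
  0 < w0 -> a0 * w <= a * w0 -> y <= y' -> x <= x' ->
  x' * w0 + a0 * y <= x * w0 + a0 * y' -> x' * w + a * y <= x * w + a * y'.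
Proof.
move=> w0_gt0 aw yy xx; rewrite -(subnK yy) -(subnK xx).
move: (x' - x) (y' - y) => u v; rewrite !mulnDl !mulnDr => h.
have {}h : u * w0 <= a0 * v by lia.
suff : u * w <= a * v by lia.
rewrite -(leq_pmul2r w0_gt0) mulnAC (leq_trans (leq_mul h (leqnn w))) //.
by rewrite mulnAC [leqRHS]mulnAC leq_mul2r aw orbT.
Qed.

Section Greedy.

(** [al j] is the number of points for position [j], [Q i c] the position of candidate [c] in vote
    [i], and [pr i k] the price of shift [k] there. Indices are plain numbers, to match memory
    cells. *)
Variables (m n p : nat) (al : nat -> nat) (Q pr : nat -> nat -> nat).

Notation P i := (Q i p).

Definition sc (s : nat -> nat) (c : nat) : nat :=
  \sum_(i < n) al (npos (P i) (s i) (Q i c)).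

Lemma eq_sc s t c : (forall i, i < n -> s i = t i) -> sc s c = sc t c.
Proof. by move=> st; apply: eq_bigr => i _; rewrite st. Qed.

Definition win (s : nat -> nat) : Prop := forall c, c < m -> sc s c <= sc s p.

Definition cost (s : nat -> nat) : nat := \sum_(i < n) pr i (s i).

Definition gain (s : nat -> nat) i k := al (P i - k) - al (P i - s i).

Definition cost_diff (s : nat -> nat) i k := pr i k - pr i (s i).

Definition extension b (s : nat -> nat) i k :=
  [&& i < n, s i < k, k <= P i & pr i k <= b].

Definition override (s : nat -> nat) j l : nat -> nat :=
  fun i => if i == j then l else s i.

Definition valid (s : nat -> nat) := forall i, i < n -> s i <= P i.

Lemma valid_override s j l : valid s -> l <= P j -> valid (override s j l).
Proof. by move=> vs lP i ltin; rewrite /override; case: eqP => [->|_] //; exact: vs. Qed.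

(** Serves for prices and for the shifts themselves; the additive form avoids truncated
    subtraction. *)
Lemma sum_override (F : nat -> nat -> nat) s j l : j < n ->
  \sum_(i < n) F i (override s j l i) + F j (s j) = \sum_(i < n) F i (s i) + F j l.
Proof.
move=> ltjn; rewrite (bigD1 (Ordinal ltjn)) //= [in RHS](bigD1 (Ordinal ltjn)) //=.
rewrite {1}/override eqxx.
rewrite (eq_bigr (fun i : 'I_n => F i (s i))); first lia.
by move=> i; rewrite /override -val_eqE /= => /negbTE ->.
Qed.

Hypothesis al_anti : forall i j, i <= j -> al j <= al i.
Hypothesis ltpm : p < m.
Hypothesis Qinj : forall i c, i < n -> c < m -> Q i c = P i -> c = p.
Hypothesis pr_mono : forall i k l, i < n -> k <= l -> l <= P i -> pr i k <= pr i l.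

Lemma sc_p s : sc s p = \sum_(i < n) al (P i - s i).
Proof. by apply: eq_bigr => i _; rewrite npos_self. Qed.

Lemma win_top s : (forall i, i < n -> s i = P i) -> win s.
Proof.
move=> sP c _; rewrite sc_p; apply: leq_sum => i _.
by rewrite (sP i (ltn_ord i)) subnn al_anti.
Qed.

Lemma npos_anti P k l j : j != P -> k <= l ->
  al (npos P l j) <= al (npos P k j).
Proof. by move=> jP kl; apply: al_anti; rewrite /npos; repeat case: ifP => ?; lia. Qed.

(* Overtaking a candidate never costs it more than the designated candidate
   gains. *)
Lemma npos_loss P k l j : j != P -> k <= l ->
  al (npos P k j) + al (P - k) <= al (npos P l j) + al (P - l).
Proof.
move=> jP kl; rewrite /npos.
have h := @al_anti (P - l) (P - k); have h1 := @al_anti (P - l) j.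
have h2 := @al_anti j.+1 (P - k).
repeat case: ifP => ?; lia.
Qed.

(** * Comparison of a losing shift-action with a winning one *)

Section Comparison.

Variables (s t : nat -> nat).

Let inf i := minn (s i) (t i).
Let sup i := maxn (s i) (t i).

Lemma cost_inf_sup : cost inf + cost sup = cost s + cost t.
Proof.
rewrite /cost -!big_split; apply: eq_bigr => i _.
by rewrite /inf /sup /=; case: leqP => _; lia.
Qed.

Lemma gain_inf_sup : sc inf p + sc sup p = sc s p + sc t p.
Proof.
rewrite !sc_p -!big_split; apply: eq_bigr => i _.
by rewrite /inf /sup /=; case: leqP => _; lia.
Qed.

(** Under [inf] the rival [c] has at least its score under [s], and from [inf] to [t] it loses at
    most what [p] gains; under [t] it does not beat [p]. *)
Lemma losing_gain c : c < m -> win t -> sc s p < sc s c ->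
  sc s p + sc inf p < 2 * sc t p.
Proof.
move=> cm tw sl.
have cp : c != p by apply: contraL sl => /eqP ->; rewrite ltnn.
have QP i : i < n -> Q i c != P i.
  by move=> ltin; apply: contraNneq cp => /(Qinj ltin cm) ->.
have le1 : sc s c <= sc inf c.
  by apply: leq_sum => i _; apply: npos_anti; [exact: QP|exact: geq_minl].
have le2 : sc inf c + sc inf p <= sc t c + sc t p.
  rewrite !sc_p -!big_split; apply: leq_sum => i _.
  by apply: npos_loss; [exact: QP|exact: geq_minr].
by have := tw c cm; lia.
Qed.

(* The Lagrangian inequalities that compare s with inf and with sup, added
   with weights 1 and 2. *)
Lemma losing_cost a w c : c < m -> win t -> sc s p < sc s c -> 0 < w ->
  (forall i, i < n -> pr i (s i) * w + a * al (P i - inf i)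
                      <= pr i (inf i) * w + a * al (P i - s i)) ->
  (forall i, i < n -> pr i (s i) * w + a * al (P i - sup i)
                      <= pr i (sup i) * w + a * al (P i - s i)) ->
  cost s + cost inf <= 2 * cost t.
Proof.
move=> cm tw sl w0 Hinf Hsup; have lg := losing_gain cm tw sl.
have S1 : cost s * w + a * sc inf p <= cost inf * w + a * sc s p.
  rewrite !sc_p /cost !big_distrl !big_distrr -!big_split /=.
  by apply: leq_sum => i _; exact: Hinf.
have S2 : cost s * w + a * sc sup p <= cost sup * w + a * sc s p.
  rewrite !sc_p /cost !big_distrl !big_distrr -!big_split /=.
  by apply: leq_sum => i _; exact: Hsup.
have := cost_inf_sup; have := gain_inf_sup => G C.
have {}lg : a * (sc s p + sc inf p) <= a * (2 * sc t p) by rewrite leq_mul2l ltnW ?orbT.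
have {}G : a * sc inf p + a * sc sup p = a * sc s p + a * sc t p by rewrite -!mulnDr G.
have {}C : cost inf * w + cost sup * w = cost s * w + cost t * w by rewrite -!mulnDl C.
(* [S1] plus twice [S2], with [sup] eliminated by [G] and [C], bounds [(cost s + cost inf) * w + a *
   (2 * sc t p - sc s p - sc inf p)] by [2 * cost t * w]; by [lg] the second summand is
   nonnegative. *)
rewrite -(leq_pmul2r w0); lia.
Qed.

(** Since [inf] earns fewer points than [t], some vote gives [p] more under [t] than under [inf];
    there [s i < t i], and extending to [t i] gains points. *)
Lemma losing_extension b c : c < m -> win t -> sc s p < sc s c -> valid t ->
  (forall i, i < n -> pr i (t i) <= b) ->
  exists i k, extension b s i k /\ 0 < gain s i k.
Proof.
move=> cm tw sl vt tb; have lg := losing_gain cm tw sl.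
have {}lg : sc inf p < sc t p.
  suff : sc inf p <= sc s p by lia.
  by rewrite !sc_p; apply: leq_sum => i _; apply: al_anti; rewrite /inf; lia.
case: (boolP [forall i : 'I_n, al (P i - t i) <= al (P i - inf i)]) => [/forallP H|].
  by move: lg; rewrite ltnNge !sc_p leq_sum // => i _; exact: H.
rewrite negb_forall => /existsP[i]; rewrite -ltnNge => lti; exists i, (t i).
have sti : s i < t i.
  by rewrite ltnNge; apply: contraL lti => le; rewrite /inf (minn_idPr le) ltnn.
rewrite /extension ltn_ord sti vt // tb //; split=> //.
by rewrite subn_gt0; apply: leq_trans lti; rewrite ltnS al_anti // /inf; lia.
Qed.

End Comparison.

(* [a / w] is the price of a point at which no vote can be improved: every
   vote minimises, over the admissible shifts, the cost minus that price times
   the number of points. *)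
Definition balanced (L : nat -> nat) b (s : nat -> nat) a w :=
  forall i k, i < n -> L i <= k -> k <= P i -> pr i k <= b ->
    pr i (s i) * w + a * al (P i - k) <= pr i k * w + a * al (P i - s i).

Definition greedy_state (L : nat -> nat) b (s : nat -> nat) :=
  [/\ forall i, i < n -> L i <= s i, valid s, forall i, i < n -> pr i (s i) <= b
    & exists a w, 0 < w /\ balanced L b s a w].

(** Smallest ratio of added cost to gain, cross-multiplied so that extensions without gain need no
    separate case. *)
Definition best_extension b s j l :=
  [/\ extension b s j l, 0 < gain s j l
    & forall i k, extension b s i k ->
        cost_diff s j l * gain s i k <= cost_diff s i k * gain s j l].

Lemma greedy_start L b : valid L -> (forall i, i < n -> pr i (L i) <= b) ->
  greedy_state L b L.
Proof.
move=> vL Lb; split=> //; exists 0, 1; split=> // i k ltin Lk kP _.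
by rewrite !mul0n !addn0 !muln1 pr_mono.
Qed.

(** The ratio [a / w] of the best extension becomes the new multiplier. *)
Lemma greedy_step L b s j l :
  greedy_state L b s -> best_extension b s j l -> greedy_state L b (override s j l).
Proof.
case=> Ls vs sb [a0 [w0 [w0_gt0 bal0]]] [/and4P[ltjn sl lP lb] g0 best].
split=> [i ltin||i ltin|].
- by rewrite /override; case: eqP => [->|_]; [have := Ls j ltjn; lia|exact: Ls].
- exact: valid_override.
- by rewrite /override; case: eqP => [->|_] //; exact: sb.
set a := cost_diff s j l; set w := gain s j l.
have w_gt0 : 0 < w := g0.
have sprice i k : i < n -> s i <= k -> k <= P i -> pr i (s i) <= pr i k.
  by move=> *; apply: pr_mono.
have spoints i k : s i <= k -> al (P i - s i) <= al (P i - k).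
  by move=> *; apply: al_anti; lia.
have aE : a + pr j (s j) = pr j l by rewrite /a /cost_diff subnK // sprice // ltnW.
have wE : w + al (P j - s j) = al (P j - l) by rewrite /w /gain subnK // spoints // ltnW.
(* The old balance, applied to the shift [l] of vote [j], shows that the multiplier does not
   decrease. *)
have a0a : a0 * w <= a * w0.
  have := bal0 j l ltjn _ lP lb; rewrite -aE -wE => /(_ _) H.
  by have {}H := H (ltnW (leq_ltn_trans (Ls j ltjn) sl)); nia.
(* Already [s] is balanced for the new multiplier: against shorter shifts because the multiplier
   rose, against longer ones because no extension has a smaller ratio. *)
have bal : balanced L b s a w.
  move=> i k ltin Lk kP kb; case: (leqP k (s i)) => [ks|sk].
    have := bal0 i k ltin Lk kP kb.
    have := pr_mono ltin ks (vs i ltin).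
    have : al (P i - k) <= al (P i - s i) by apply: al_anti; lia.
    exact: price_increase w0_gt0 a0a.
  have := best i k; rewrite /extension ltin sk kP kb => /(_ isT).
  have := sprice i k ltin (ltnW sk) kP; have := spoints i k (ltnW sk).
  rewrite -/a -/w /gain /cost_diff; nia.
(* In vote [j] the shifts [s j] and [l] tie at the new multiplier, so one may replace the other. *)
exists a, w; split=> // i k ltin Lk kP kb; rewrite /override.
case: eqP => [ij|_]; last exact: bal.
have := bal j k; rewrite -ij ltin Lk kP kb => /(_ isT isT isT isT).
by rewrite ij in Lk kP kb *; rewrite -aE -wE; nia.
Qed.

Lemma greedy_step_cost L b s j l t c :
  greedy_state L b s -> extension b s j l -> c < m -> sc s p < sc s c ->
  win t -> valid t -> (forall i, i < n -> L i <= t i) ->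
  (forall i, i < n -> pr i (t i) <= b) -> b <= cost L ->
  cost (override s j l) <= 2 * cost t.
Proof.
case=> Ls vs sb [a [w [w_gt0 bal]]] /and4P[ltjn sl lP lb] cm sl' tw vt Lt tb bL.
have lc : cost s + cost (fun i => minn (s i) (t i)) <= 2 * cost t.
  apply: (losing_cost (a := a) (w := w) cm) => // i ltin; have := (Ls i ltin, Lt i ltin).
    move=> [h1 h2]; apply: bal => //; first by lia.
      by have := vs i ltin; lia.
    by rewrite /minn; case: ifP => _; auto.
  move=> [h1 h2]; apply: bal => //; first by lia.
    by have := vs i ltin; have := vt i ltin; lia.
  by rewrite /maxn; case: ifP => _; auto.
(* Both [s] and [t] extend [L], so the minimum costs at least [b], and the new extension adds at
   most [b]. *)
have Linf : cost L <= cost (fun i => minn (s i) (t i)).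
  apply: leq_sum => i _; have := (Ls i (ltn_ord i), Lt i (ltn_ord i)) => -[h1 h2].
  by apply: pr_mono => //; [lia|have := vs i (ltn_ord i); lia].
have := sum_override pr s l ltjn; rewrite -/(cost s) -/(cost _); lia.
Qed.

End Greedy.

(** * The program *)

(* Arrays 0 and 1 are the input and array 2 is the output. The others are:
     3   position of the designated candidate in every vote
     4   running offset of the price lists in the input
     5   price table, with rows of length m
     6   current shift-action, 7 its scores, 8 whether it is successful
     9   cap on the price of an extension
    10, 11, 12, 13   cost, gain, voter and shift of the best extension
    14  cost of the current shift-action
    15  whether a successful shift-action has been output, 16 its cost
    17  position of a candidate after a shift
    20 - 25   loop counters.
   Scalars and loop counters are in cell 0 of their arrays. *)

Declare Scope prog_scope.
Delimit Scope prog_scope with P.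
Local Open Scope prog_scope.

Notation "x +' y" := (Op Add x y) (at level 50, left associativity) : prog_scope.
Notation "x -' y" := (Op Defs.Sub x y) (at level 50, left associativity) : prog_scope.
Notation "x *' y" := (Op Mul x y) (at level 40, left associativity) : prog_scope.
Notation "p ;; q" := (PSeq p q) (at level 80, right associativity) : prog_scope.
Notation V a := (Get a (Const 0)).
Notation cell a i j := (Get a (i *' V 1 +' j)).
Notation vote_at i j := (Get 1 (Const 3 +' (i *' V 1 +' j))).

(** Evaluates [npos] for the voter in array 24 and the position in array 25. Truncated subtraction
    acts as a strict comparison. *)
Definition place : prog :=
  PIf (Get 3 (V 24) -' Get 6 (V 24) -' V 25) (PSet 17 (Const 0) (V 25))
  (PIf (Get 3 (V 24) -' V 25) (PSet 17 (Const 0) (V 25 +' Const 1))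
  (PIf (V 25 -' Get 3 (V 24)) (PSet 17 (Const 0) (V 25))
       (PSet 17 (Const 0) (Get 3 (V 24) -' Get 6 (V 24))))).

Definition tally : prog :=
  place ;;
  PSet 7 (vote_at (V 24) (V 25)) (Get 7 (vote_at (V 24) (V 25)) +' Get 0 (V 17)).

Definition verdict : prog :=
  PIf (Get 7 (V 24) -' Get 7 (Get 1 (Const 2))) (PSet 8 (Const 0) (Const 0)) PSkip.

Definition check : prog :=
  PFor 24 0 (PSet 7 (V 24) (Const 0)) ;;
  PFor 24 1 (PFor 25 0 tally) ;;
  PSet 8 (Const 0) (Const 1) ;;
  PFor 24 0 verdict.

Definition diff_cost := cell 5 (V 24) (V 25) -' cell 5 (V 24) (Get 6 (V 24)).

Definition diff_gain :=
  Get 0 (Get 3 (V 24) -' V 25) -' Get 0 (Get 3 (V 24) -' Get 6 (V 24)).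

(** The product in the first test is the conjunction of [s i < k] and [k <= P i]. *)
Definition compare : prog :=
  PIf ((V 25 -' Get 6 (V 24)) *' (Get 3 (V 24) +' Const 1 -' V 25))
   (PIf (V 9 +' Const 1 -' cell 5 (V 24) (V 25))
     (PIf (V 10 *' diff_gain -' diff_cost *' V 11)
        (PSet 10 (Const 0) diff_cost ;; PSet 11 (Const 0) diff_gain ;;
         PSet 12 (Const 0) (V 24) ;; PSet 13 (Const 0) (V 25))
        PSkip)
     PSkip)
   PSkip.

(** The initial ratio 1 / 0 stands for infinity: exactly the extensions with positive gain beat
    it. *)
Definition improve : prog :=
  PSet 10 (Const 0) (Const 1) ;; PSet 11 (Const 0) (Const 0) ;;
  PFor 24 1 (PFor 25 0 compare) ;;
  PIf (V 11) (PSet 6 (V 12) (V 13)) PSkip.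

Definition step : prog := check ;; PIf (V 8) PSkip improve.

Definition record : prog :=
  PSet 15 (Const 0) (Const 1) ;; PSet 16 (Const 0) (V 14) ;;
  PFor 24 1 (PSet 2 (V 24) (Get 6 (V 24))).

Definition add_prices : prog :=
  PFor 24 1 (PSet 14 (Const 0) (V 14 +' cell 5 (V 24) (Get 6 (V 24)))).

Definition evaluate : prog :=
  check ;; PSet 14 (Const 0) (Const 0) ;; add_prices ;;
  PIf (V 8 *' ((Const 1 -' V 15) +' (V 16 -' V 14)))
      record PSkip.

Definition start : prog :=
  PSet 9 (Const 0) (cell 5 (V 20) (V 21)) ;;
  PFor 22 1 (PSet 6 (V 22) (Const 0)) ;;
  PSet 6 (V 20) (V 21).

(** Each improvement raises the sum of the shifts, which stays below [n * m]; hence among [n * m]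
    steps one is idle, and then [p] wins or no extension gains points. *)
Definition try_guess : prog :=
  PIf (Get 3 (V 20) +' Const 1 -' V 21)
   (start ;; PFor 22 1 (PFor 23 0 step) ;; evaluate)
   PSkip.

Definition read_candidate : prog :=
  PIf (vote_at (V 20) (V 21) -' Get 1 (Const 2)) PSkip
  (PIf (Get 1 (Const 2) -' vote_at (V 20) (V 21)) PSkip (PSet 3 (V 20) (V 21))).

(** The offset starts at 2 although the votes start in cell 3: price lists begin with shift 1, so
    the price of shift [k] is found at offset plus [k]. *)
Definition read_positions : prog :=
  PSet 4 (Const 0) (Const 2) ;;
  PFor 20 1 (PSet 4 (Const 0) (V 4 +' V 1) ;; PFor 21 0 read_candidate).

Definition read_price : prog :=
  PIf (V 21 *' (Get 3 (V 20) +' Const 1 -' V 21))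
      (PSet 5 (V 20 *' V 1 +' V 21) (Get 1 (V 4 +' V 21))) PSkip.

Definition read_prices : prog :=
  PFor 20 1 (PFor 21 0 read_price ;; PSet 4 (Const 0) (V 4 +' Get 3 (V 20))).

Definition algorithm : prog :=
  read_positions ;; read_prices ;; PFor 20 1 (PFor 21 0 try_guess).

Lemma wf_algorithm : wf algorithm. Proof. by []. Qed.

(** * Correctness of the program *)

Section Correctness.

Variables (m n p : nat) (al : nat -> nat) (vt Q pr : nat -> nat -> nat).

Notation P i := (Q i p).

Hypothesis ltpm : p < m.
Hypothesis vtQ : forall i c j, i < n -> c < m -> j < m -> (vt i j == c) = (j == Q i c).
Hypothesis Q_lt : forall i c, i < n -> c < m -> Q i c < m.

Hypothesis al_anti : forall i j, i <= j -> al j <= al i.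
Hypothesis pr_mono : forall i k l, i < n -> k <= l -> l <= P i -> pr i k <= pr i l.
Hypothesis pr0 : forall i, pr i 0 = 0.

Lemma Q_inj i c : i < n -> c < m -> Q i c = P i -> c = p.
Proof.
move=> ltin ltcm QP.
have /eqP <- : vt i (Q i c) == c by rewrite vtQ ?Q_lt.
by apply/eqP; rewrite vtQ ?Q_lt // QP.
Qed.

Record input_ok (st : state) : Prop := InputOk {
  in_al : forall j, st 0 j = al j;
  in_m : st 1 0 = m;
  in_n : st 1 1 = n;
  in_p : st 1 2 = p;
  in_vt : forall i j, i < n -> j < m -> st 1 (3 + (i * m + j)) = vt i j }.

Record tables_ok (st : state) : Prop := TablesOk {
  in_ok :> input_ok st;
  tab_P : forall i, i < n -> st 3 i = P i;
  tab_pr : forall i k, i < n -> k <= P i -> st 5 (i * m + k) = pr i k }.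

Lemma input_ok_eq st st' :
  st' 0 = st 0 -> st' 1 = st 1 -> input_ok st -> input_ok st'.
Proof. by move=> e0 e1 [*]; split; rewrite ?e0 ?e1. Qed.

Lemma tables_ok_eq st st' :
  st' 0 = st 0 -> st' 1 = st 1 -> st' 3 = st 3 -> st' 5 = st 5 ->
  tables_ok st -> tables_ok st'.
Proof.
move=> e0 e1 e3 e5 [ok H3 H5]; split; rewrite ?e3 ?e5 //.
exact: input_ok_eq ok.
Qed.

Lemma tables_ok_run q st :
  ~~ has (mem (writes q)) [:: 0; 1; 3; 5] -> tables_ok st -> tables_ok (run q st).
Proof.
rewrite /= orbF !negb_or => /and4P[? ? ? ?] ok.
by apply: tables_ok_eq ok; rewrite run_frame.
Qed.

Lemma run_place st i j : tables_ok st -> st 24 0 = i -> st 25 0 = j -> i < n ->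
  run place st 17 0 = npos (P i) (st 6 i) j.
Proof.
move=> ok iE jE ltin; rewrite /= iE jE (tab_P ok ltin) /npos.
rewrite -!lt0n !subn_gt0 addn1.
case: (j < P i - st 6 i) => //; case: (j < P i) => //.
by case: (P i < j).
Qed.

Lemma run_seq q q' st : run (q ;; q') st = run q' (run q st).
Proof. by []. Qed.

Lemma run_tally st i j c : tables_ok st -> st 24 0 = i -> st 25 0 = j ->
  i < n -> j < m -> c < m ->
  run tally st 7 c = st 7 c + (j == Q i c) * al (npos (P i) (st 6 i) j).
Proof.
move=> ok iE jE ltin ltjm ltcm; rewrite run_seq.
have := run_place ok iE jE ltin.
have : forall a, a != 17 -> run place st a = st a.
  by move=> a a17; rewrite run_frame //= !inE (negbTE a17).
move: (run place st) => st1 F q /=.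
rewrite /update /= q !F // iE jE (in_m ok) (in_al ok) (in_vt ok) //.
rewrite eq_sym vtQ //; case: eqP => [jQ|_]; last by rewrite addn0.
by rewrite mul1n; have /eqP -> : vt i j == c by rewrite vtQ // jQ.
Qed.

Lemma run_tallies st s : tables_ok st -> (forall i, i < n -> st 6 i = s i) ->
  (forall c, c < m -> st 7 c = 0) ->
  forall c, c < m -> run (PFor 24 1 (PFor 25 0 tally)) st 7 c = sc n p al Q s c.
Proof.
move=> ok sE S0 c ltcm.
pose I k (st' : state) := st' 7 c = sc k p al Q s c.
rewrite -/(I n _); apply: for_rule (in_n ok) _ _ => //.
  by rewrite /I /sc big_ord0; apply: S0.
move=> k st1 ltkn kE F Ik; rewrite /I.
have ok1 : tables_ok st1 by apply: tables_ok_eq ok; exact: F.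
(* Position [j] counts for [c] only if [c] stands there, so the full sum over [j] leaves one
   term. *)
pose J l (st' : state) :=
  st' 7 c = sc k p al Q s c + \sum_(j < l) (val j == Q k c) * al (npos (P k) (s k) j).
have -> : update (run (PFor 25 0 tally) st1) 24 0 k.+1 7 = run (PFor 25 0 tally) st1 7.
  by [].
have -> : sc k.+1 p al Q s c =
   sc k p al Q s c + \sum_(j < m) (val j == Q k c) * al (npos (P k) (s k) j).
  rewrite /sc big_ord_recr /=; congr (_ + _).
  rewrite (bigD1 (Ordinal (Q_lt ltkn ltcm))) //= eqxx mul1n big1 ?addn0 // => j.
  by rewrite -val_eqE /= => /negbTE ->.
rewrite -/(J m _); apply: for_rule (in_m ok1) _ _ => //.
  by rewrite /J big_ord0 addn0; exact: Ik.
move=> l st2 ltlm lE F2 Jl.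
have ok2 : tables_ok st2 by apply: tables_ok_eq ok1; exact: F2.
rewrite /J big_ord_recr /=.
have -> : update (run tally st2) 25 0 l.+1 7 c = run tally st2 7 c by [].
have kE2 : st2 24 0 = k by rewrite F2.
by rewrite (run_tally ok2 kE2 lE) // Jl F2 // F // sE // addnA.
Qed.

Lemma run_check st s : tables_ok st -> (forall i, i < n -> st 6 i = s i) ->
  reflect (win m n p al Q s) (run check st 8 0 != 0).
Proof.
move=> ok sE; rewrite run_seq.
set st1 := run (PFor 24 0 _) st.
have F1 : forall a, a != 24 -> a != 7 -> st1 a = st a.
  by move=> a a1 a2; rewrite /st1 run_frame //= !inE (negbTE a1).
have ok1 : tables_ok st1 by apply: tables_ok_run.
have S0 : forall c, c < m -> st1 7 c = 0.
  pose I k (st' : state) := forall c, c < k -> st' 7 c = 0.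
  suff : I m st1 by []; apply: for_rule (in_m ok) _ _ => //
    k st' ltkm kE _ Ik c.
  by rewrite /= /update /= kE; case: eqP => // ck ltck; apply: Ik; lia.
rewrite run_seq.
have := run_tallies ok1 _ S0 => /(_ s); rewrite F1 // => /(_ sE).
set st2 := run _ st1 => scE; rewrite run_seq.
have ok2 : tables_ok st2 by apply: tables_ok_run.
set st3 := run _ st2.
have F3 a : a != 8 -> st3 a = st2 a by move=> a8; rewrite /st3 run_frame // inE a8.
have ok3 : tables_ok st3 by apply: tables_ok_eq ok2; exact: F3.
pose I k (st' : state) :=
  (forall c, c < k -> sc n p al Q s c <= sc n p al Q s p) <-> (st' 8 0 != 0).
suff winE : I m (run (PFor 24 0 verdict) st3) by apply: (iffP idP); case: winE.
apply: for_rule (in_m ok3) _ _ => //.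
move=> k st4 ltkm kE F4 Ik; rewrite /I.
have S4 c : c < m -> st4 7 c = sc n p al Q s c by move=> ltcm; rewrite F4 // F3 // scE.
have -> : update (run verdict st4) 24 0 k.+1 8 0 =
    if sc n p al Q s p < sc n p al Q s k then 0 else st4 8 0.
  rewrite /update /= kE S4 // (F4 1) // (in_p ok3) S4 //.
  by rewrite -lt0n subn_gt0; case: ifP.
case: ltnP => [lt|le].
  by split=> // /(_ k (ltnSn k)); rewrite leqNgt lt.
split=> [H|/Ik H c].
  by apply/Ik => c ltck; apply: H; apply: ltnW.
by rewrite ltnS leq_eqVlt => /predU1P[->|/H].
Qed.

(** [seen] marks the pairs already compared. While the ratio is still 1 / 0, the first clause says
    that every extension seen has gain 0. *)
Definition best_so_far (s : nat -> nat) b (seen : nat -> nat -> Prop) (st : state) :=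
  (forall i k, seen i k -> extension n p Q pr b s i k ->
     st 10 0 * gain p al Q s i k <= cost_diff pr s i k * st 11 0) /\
  ((st 11 0 = 0 /\ st 10 0 = 1) \/
   [/\ 0 < st 11 0, extension n p Q pr b s (st 12 0) (st 13 0),
       st 10 0 = cost_diff pr s (st 12 0) (st 13 0)
     & st 11 0 = gain p al Q s (st 12 0) (st 13 0)]).

Lemma run_compare st s b i k (seen : nat -> nat -> Prop) :
  tables_ok st -> (forall i, i < n -> st 6 i = s i) -> valid n p Q s -> st 9 0 = b ->
  st 24 0 = i -> st 25 0 = k -> i < n ->
  best_so_far s b seen st ->
  best_so_far s b (fun i' k' => seen i' k' \/ (i' = i /\ k' = k)) (run compare st).
Proof.
move=> ok sE vs bE iE kE ltin [Hseen Hbest].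
have skip : ~ (extension n p Q pr b s i k /\
     cost_diff pr s i k * st 11 0 < st 10 0 * gain p al Q s i k) ->
    best_so_far s b (fun i' k' => seen i' k' \/ (i' = i /\ k' = k)) st.
  move=> nE; split=> // i' k' [|[-> ->]] ext; first by move=> *; apply: Hseen.
  by rewrite leqNgt; apply/negP => lt; apply: nE.
have expE : (k - s i) * (P i + 1 - k) != 0 = (s i < k) && (k <= P i).
  by rewrite muln_eq0 negb_or; lia.
rewrite /= iE kE bE (tab_P ok ltin) sE // expE.
case: ifP => [/andP[sk kP]|nsk]; last first.
  by apply: skip; case => /and4P[_ h1 h2 _]; rewrite h1 h2 in nsk.
rewrite !(in_m ok) !(tab_pr ok) ?vs //.
rewrite !(in_al ok) -/(gain p al Q s i k) -/(cost_diff pr s i k).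
rewrite -!lt0n !subn_gt0 addn1 ltnS.
case: ifP => [kb|nkb]; last first.
  by apply: skip; case => /and4P[_ _ _ h]; rewrite h in nkb.
have ext : extension n p Q pr b s i k by apply/and4P.
case: ifP => [better|nbetter]; last first.
  by apply: skip; case => _; rewrite nbetter.
set st' := (X in best_so_far _ _ _ X).
have e10 : st' 10 0 = cost_diff pr s i k by [].
have e11 : st' 11 0 = gain p al Q s i k.
  by rewrite /st' /update /= iE kE (tab_P ok ltin) sE // !(in_al ok).
have e12 : st' 12 0 = i by [].
have e13 : st' 13 0 = k by [].
split; last first.
  right; rewrite e10 e11 e12 e13; split=> //.
  by move: better; case: (gain _ _ _ _ _ _) => //; rewrite muln0.
rewrite e10 e11 => i' k' [seen'|[-> ->]] ext'; last by rewrite mulnC.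
have old := Hseen i' k' seen' ext'.
(* Comparison of ratios is transitive: the positive old gain is multiplied in and cancelled. From 1
   / 0, all earlier gains vanish. *)
case: Hbest => [[g0 c1]|[g0 _ _ _]].
  by move: old; rewrite g0 c1 muln0 mul1n leqn0 => /eqP ->; rewrite muln0.
rewrite -(leq_pmul2r g0) mulnAC.
apply: leq_trans (leq_mul (ltnW better) (leqnn _)) _.
by rewrite mulnAC [leqRHS]mulnAC leq_mul2r old orbT.
Qed.

Lemma run_search st s b :
  tables_ok st -> (forall i, i < n -> st 6 i = s i) -> valid n p Q s -> st 9 0 = b ->
  st 10 0 = 1 -> st 11 0 = 0 ->
  best_so_far s b (fun i k => True) (run (PFor 24 1 (PFor 25 0 compare)) st).
Proof.
move=> ok sE vs bE c1 g0.
have [H1 H2] : best_so_far s b (fun i _ => i < n)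
                 (run (PFor 24 1 (PFor 25 0 compare)) st).
  pose I k (st' : state) := best_so_far s b (fun i _ => i < k) st'.
  apply: (for_rule (I := I)) (in_n ok) _ _ => //; first by split=> //; left.
  move=> i st1 ltin iE F Ii.
  have ok1 : tables_ok st1 by apply: tables_ok_eq ok; exact: F.
  pose J l (st' : state) := best_so_far s b (fun i' k' => i' < i \/ i' = i /\ k' < l) st'.
  have [H1 H2] : J m (run (PFor 25 0 compare) st1).
    apply: (for_rule (I := J)) (in_m ok1) _ _ => //.
      by case: Ii => H1 H2; split=> // i' k' [|[_ //]]; exact: H1.
    move=> k st2 ltkm kE F2 Jk.
    have ok2 : tables_ok st2 by apply: tables_ok_eq ok1; exact: F2.
    have iE2 : st2 24 0 = i by rewrite F2.
    have [| |H1 H2] := run_compare ok2 _ vs _ iE2 kE ltin Jk.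
    - by move=> i' lti'; rewrite F2 // F // sE.
    - by rewrite F2 // F // bE.
    by split=> // i' k' h; apply: H1; lia.
  (* Extensions stop at the position of [p], below [m], so the inner loop meets all of them. *)
  split=> // i' k' lti' ext; apply: H1 => //.
  have /and4P[lti'n _ k'P _] := ext; have := Q_lt lti'n ltpm; lia.
by split=> // i k _ ext; apply: H1 => //; case/and4P: ext.
Qed.

Definition losing s := exists2 c, c < m & sc n p al Q s p < sc n p al Q s c.

Lemma not_win s : ~ win m n p al Q s -> losing s.
Proof.
move=> nw.
case: (boolP [forall c : 'I_m, sc n p al Q s c <= sc n p al Q s p]) => [/forallP H|].
  by case: nw => c ltcm; exact: (H (Ordinal ltcm)).
rewrite negb_forall => /existsP[c]; rewrite -ltnNge => lt; exists (val c) => //.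
exact: ltn_ord.
Qed.

Definition stuck b s := forall i k, extension n p Q pr b s i k -> gain p al Q s i k = 0.

Definition step_spec b (s s' : nat -> nat) : Prop :=
  [\/ win m n p al Q s /\ s' = s,
      stuck b s /\ s' = s
    | losing s /\
      exists j l, best_extension n p al Q pr b s j l /\ s' = override s j l].

Lemma run_step st : tables_ok st -> valid n p Q (st 6) ->
  step_spec (st 9 0) (st 6) (run step st 6).
Proof.
move=> ok vs; rewrite run_seq.
have ok1 : tables_ok (run check st) by apply: tables_ok_run.
have e6 : run check st 6 = st 6 by rewrite run_frame.
have e9 : run check st 9 = st 9 by rewrite run_frame.
have Hwin := @run_check st _ ok (fun _ _ => erefl).
move: (run check st) ok1 e6 e9 Hwin => st1 ok1 e6 e9 Hwin.
have -> : run (PIf (V 8) PSkip improve) st1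
          = if st1 8 0 != 0 then st1 else run improve st1 by [].
case: Hwin => [w|/not_win lose]; first by rewrite e6; constructor 1.
rewrite !run_seq; set st2 := run (PSet 11 _ _) _.
have ok2 : tables_ok st2 by apply: tables_ok_eq ok1.
have [e26 e29] : st2 6 = st 6 /\ st2 9 = st 9 by rewrite -e6 -e9.
have := @run_search st2 (st 6) (st 9 0) ok2 _ vs _ erefl erefl.
rewrite e26 e29 => /(_ (fun _ _ => erefl) erefl).
have : run (PFor 24 1 (PFor 25 0 compare)) st2 6 = st2 6 by rewrite run_frame.
move: (run _ st2) => st3; rewrite e26 => st36 [Hall Hbest].
have -> : run (PIf (V 11) (PSet 6 (V 12) (V 13)) PSkip) st3
          = if st3 11 0 != 0 then update st3 6 (st3 12 0) (st3 13 0) else st3 by [].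
case: Hbest => [[g0 c1]|[g0 ext cE gE]].
  constructor 2; rewrite g0 /=; split=> // i k ext.
  by have := Hall i k I ext; rewrite g0 c1 muln0 mul1n leqn0 => /eqP.
constructor 3; split=> //; exists (st3 12 0), (st3 13 0); rewrite -lt0n g0; split.
  split=> //; first by rewrite -gE.
  by move=> i k ext'; rewrite -cE -gE; apply: Hall.
by rewrite -st36.
Qed.

(** [G] is left open: it is trivial for an arbitrary guess and carries the cost bound for the right
    one. *)
Lemma run_steps (G : (nat -> nat) -> Prop) st :
  tables_ok st -> valid n p Q (st 6) -> G (st 6) ->
  (forall s j l, G s -> losing s -> best_extension n p al Q pr (st 9 0) s j l ->
     G (override s j l)) ->
  let s := run (PFor 22 1 (PFor 23 0 step)) st 6 in
  [/\ valid n p Q s, G s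
    & [\/ win m n p al Q s, stuck (st 9 0) s | n * m <= \sum_(i < n) s i]].
Proof.
move=> ok vs Gs Gstep.
pose inv k s := [/\ valid n p Q s, G s
    & [\/ win m n p al Q s, stuck (st 9 0) s | k <= \sum_(i < n) s i]].
have next k s s' : inv k s -> step_spec (st 9 0) s s' -> inv k.+1 s'.
  move=> [v Gs' stop] [[w ->]|[stk ->]|[lose [j [l [best ->]]]]].
  - by split=> //; constructor 1.
  - by split=> //; constructor 2.
  have [/and4P[ltjn sl lP _] g0 _] := best.
  split; [exact: valid_override|exact: Gstep|case: stop => [w|stk|le]].
  - by case: lose => c ltcm; rewrite ltnNge w.
  - by have [ext _ _] := best; rewrite (stk _ _ ext) in g0.
  constructor 3; have := sum_override (fun i x => x) s l ltjn; move: le sl.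
  by move=> le sl /= h; move: (\sum_(i < n) _) (\sum_(i < n) _) h le => a a'; lia.
pose I k (st' : state) := inv (k * m) (st' 6).
apply: (for_rule (I := I)) (in_n ok) _ _ => //; first by split=> //; constructor 3.
move=> u st1 ltun _ F Iu.
have ok1 : tables_ok st1 by apply: tables_ok_eq ok; exact: F.
pose J k (st' : state) := inv (u * m + k) (st' 6).
suff H : J m (run (PFor 23 0 step) st1) by rewrite /I mulSnr; exact: H.
apply: (for_rule (I := J)) (in_m ok1) _ _ => //; first by rewrite /J addn0.
move=> v st2 _ _ F2 Jv.
have ok2 : tables_ok st2 by apply: tables_ok_eq ok1; exact: F2.
have := @run_step st2 ok2; case: (Jv) => vs2 _ _ => /(_ vs2).
by rewrite F2 // F // /J addnS; apply: next.
Qed.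

Definition out_ok (st : state) : Prop := st 15 0 != 0 ->
  [/\ valid n p Q (st 2), win m n p al Q (st 2) & cost n pr (st 2) = st 16 0].

Definition found v (st : state) : Prop := st 15 0 != 0 /\ st 16 0 <= v.

Lemma run_evaluate st : tables_ok st -> valid n p Q (st 6) -> out_ok st ->
  let st' := run evaluate st in
  [/\ out_ok st', forall v, found v st -> found v st'
    & win m n p al Q (st 6) -> found (cost n pr (st 6)) st'].
Proof.
move=> ok vs out; rewrite 3!run_seq.
have ok1 : tables_ok (run check st) by apply: tables_ok_run.
have Hwin := @run_check st _ ok (fun _ _ => erefl).
have F1 : forall a, a \notin writes check -> run check st a = st a.
  by move=> a; exact: run_frame.
move: (run check st) ok1 F1 Hwin => st1 ok1 F1 Hwin.
set st2 := run (PSet 14 _ _) st1.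
have ok2 : tables_ok st2 by apply: tables_ok_eq ok1.
have ok3 : tables_ok (run add_prices st2) by apply: tables_ok_run.
have F3 : forall a, a \notin writes add_prices -> run add_prices st2 a = st2 a.
  by move=> a; exact: run_frame.
have cE : run add_prices st2 14 0 = cost n pr (st 6).
  pose I k (st' : state) := st' 14 0 = cost k pr (st 6).
  suff : I n (run add_prices st2) by [].
  apply: for_rule (in_n ok2) _ _ => //; first by rewrite /I /cost big_ord0.
  move=> k st' ltkn kE F Ik; rewrite /I /cost big_ord_recr /=.
  rewrite /update /= Ik kE (F 6) // (F 1) // (F 5) // (in_m ok2).
  have -> : st2 6 = st 6 by rewrite -[RHS]F1.
  by rewrite (tab_pr ok2) // vs.
move: (run add_prices st2) ok3 F3 cE => st3 ok3 F3 cE.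
have [e6 e15 e16 e2] : [/\ st3 6 = st 6, st3 15 = st 15, st3 16 = st 16 & st3 2 = st 2].
  by rewrite !F3 //; split; rewrite -[RHS]F1.
have e8 : st3 8 0 = st1 8 0 by rewrite F3.
set s4 := run _ st3; have -> : s4 =
  if st3 8 0 * ((1 - st3 15 0) + (st3 16 0 - st3 14 0)) != 0
  then run record st3 else st3 by [].
rewrite e8 e15 e16 cE muln_eq0 negb_or.
case: ifP => [/andP[/Hwin w better]|worse]; last first.
  split=> [|v|/Hwin w]; first by rewrite /out_ok e15 e16 e2.
    by rewrite /found e15 e16.
  by move: worse; rewrite w /found e15 e16; lia.
have [r15 r16] : run record st3 15 0 = 1 /\ run record st3 16 0 = cost n pr (st 6).
  by split; rewrite 2!run_seq run_frame //.
have r2 : forall i, i < n -> run record st3 2 i = st 6 i.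
  rewrite 2!run_seq; set st4 := run (PSet 16 _ _) _.
  have ok4 : tables_ok st4 by apply: tables_ok_eq ok3.
  pose I k (st' : state) := forall i, i < k -> st' 2 i = st 6 i.
  apply: (for_rule (I := I)) (in_n ok4) _ _ => // k st' ltkn kE F Ik i lti.
  rewrite /= /update /= kE (F 6) //; case: eqP => [->|ne]; first by rewrite -e6.
  by apply: Ik; lia.
split.
- move=> _; split.
  + by move=> i ltin; rewrite r2 // vs.
  + by move=> c /w; rewrite !(@eq_sc n p al Q _ _ _ r2).
  + by rewrite r16; apply: eq_bigr => i _; rewrite r2.
- by move=> v [f le]; split; rewrite ?r15 // r16; lia.
- by move=> _; split; rewrite ?r15 // r16.
Qed.

Lemma run_start st i k : tables_ok st -> st 20 0 = i -> st 21 0 = k ->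
  i < n -> k <= P i ->
  run start st 9 0 = pr i k /\
  forall j, j < n -> run start st 6 j = if j == i then k else 0.
Proof.
move=> ok iE kE ltin kP; rewrite 2!run_seq.
have e9 : run (PSet 9 (Const 0) (cell 5 (V 20) (V 21))) st 9 0 = pr i k.
  by rewrite /= /update /= iE kE (in_m ok) (tab_pr ok).
set st1 := run (PSet 9 _ _) st in e9 *.
have ok1 : tables_ok st1 by apply: tables_ok_eq ok.
set zero := PFor 22 1 _.
have F : forall a, a \notin writes zero -> run zero st1 a = st1 a.
  by move=> a; exact: run_frame.
have zeroE : forall j, j < n -> run zero st1 6 j = 0.
  pose I k (st' : state) := forall j, j < k -> st' 6 j = 0.
  apply: (for_rule (I := I)) (in_n ok1) _ _ => // l st' _ lE _ Il j ltj.
  by rewrite /= /update /= lE; case: eqP => // ne; apply: Il; lia.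
move: (run zero st1) F zeroE => st2 F zeroE; split; first by rewrite -e9 -F.
move=> j ltjn; rewrite /= /update /= (F 20) // (F 21) //.
have -> : st1 20 0 = i by rewrite -iE.
have -> : st1 21 0 = k by rewrite -kE.
by case: eqP => // _; exact: zeroE.
Qed.

Lemma run_try_guess st i k : tables_ok st -> st 20 0 = i -> st 21 0 = k -> i < n ->
  out_ok st ->
  let st' := run try_guess st in
  [/\ out_ok st', forall v, found v st -> found v st'
    & forall t, win m n p al Q t -> valid n p Q t -> t i = k ->
        (forall j, j < n -> pr j (t j) <= pr i k) -> found (2 * cost n pr t) st'].
Proof.
move=> ok iE kE ltin out; cbv zeta.
have -> : run try_guess st = if st 3 (st 20 0) + 1 - st 21 0 != 0 then
     run evaluate (run (PFor 22 1 (PFor 23 0 step)) (run start st)) else st by [].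
rewrite iE kE (tab_P ok ltin) -lt0n subn_gt0 addn1 ltnS.
case: ifP => [kP|kP]; last first.
  by split=> // t _ vt' tk; have := vt' i ltin; rewrite tk kP.
have [e9 LE] := run_start ok iE kE ltin kP.
have ok1 : tables_ok (run start st) by apply: tables_ok_run.
have F : forall a, a \notin writes start -> run start st a = st a.
  by move=> a; exact: run_frame.
move: (run start st) e9 LE ok1 F => st1 e9 LE ok1 F.
have vL : valid n p Q (st1 6) by move=> j ltjn; rewrite LE //; case: eqP => // ->.
set loop := PFor 22 1 _.
have ok2 : tables_ok (run loop st1) by apply: tables_ok_run.
have F2 : forall a, a \notin writes loop -> run loop st1 a = st1 a.
  by move=> a; exact: run_frame.
have out2 : out_ok (run loop st1).
  by rewrite /out_ok !F2 // !F //; exact: out.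
(* Validity must hold for every guess, also a wrong one, so the trivial invariant is used. *)
have v2 : valid n p Q (run loop st1 6).
  by have [] := @run_steps (fun=> True) st1 ok1 vL I (fun _ _ _ _ _ _ => I).
have [o3 f3 w3] := run_evaluate ok2 v2 out2; split=> //.
  by move=> v fv; apply: f3; rewrite /found !F2 // !F.
move=> t tw tv tk tb.
pose G s := greedy_state n p al Q pr (st1 6) (pr i k) s /\ cost n pr s <= 2 * cost n pr t.
have Lb j : j < n -> pr j (st1 6 j) <= pr i k.
  by move=> ltjn; rewrite LE //; case: eqP => [->|_] //; rewrite pr0.
have Lt j : j < n -> st1 6 j <= t j.
  by move=> ltjn; rewrite LE //; case: eqP => // ->; rewrite tk.
have bL : pr i k <= cost n pr (st1 6).
  by rewrite /cost (bigD1 (Ordinal ltin)) //= LE // eqxx leq_addr.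
have costL : cost n pr (st1 6) <= 2 * cost n pr t.
  apply: (@leq_trans (cost n pr t)); last by rewrite leq_pmull.
  by apply: leq_sum => j _; apply: pr_mono; rewrite ?Lt ?tv.
have G0 : G (st1 6) by split=> //; apply: greedy_start.
have Gstep s j l : G s -> losing s -> best_extension n p al Q pr (st1 9 0) s j l ->
    G (override s j l).
  rewrite e9 => -[gs _] [c ltcm lose] best; split.
    by apply: greedy_step gs best.
  have [ext _ _] := best.
  by apply: (greedy_step_cost al_anti ltpm Q_inj pr_mono gs ext ltcm lose).
have [_ [gs cs] stop] := run_steps ok1 vL G0 Gstep.
have [w|nw] : win m n p al Q (run loop st1 6) \/ ~ win m n p al Q (run loop st1 6).
  by case: (boolP (run check (run loop st1) 8 0 != 0)) =>
    /(run_check ok2 (fun _ _ => erefl)); [left|right].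
  by case: (w3 w) => f le; split=> //; apply: leq_trans le cs.
(* Losing is impossible: [t] respects the cap and so supplies a gaining extension, while the sum of
   the shifts cannot reach [n * m]. *)
have [c ltcm lose] := not_win nw; case: stop => [//|stk|le].
  have [j [l [ext g0]]] :=
    losing_extension al_anti ltpm Q_inj ltcm tw lose tv tb.
  by rewrite e9 in stk; rewrite (stk _ _ ext) in g0.
have := ltn_sum_const (leq_ltn_trans (leq0n i) ltin)
          (fun j ltjn => leq_ltn_trans (v2 j ltjn) (Q_lt ltjn ltpm)).
by rewrite ltnNge le.
Qed.

Lemma run_guesses st : tables_ok st -> st 15 0 = 0 -> 0 < n ->
  let st' := run (PFor 20 1 (PFor 21 0 try_guess)) st in
  out_ok st' /\
  forall t, win m n p al Q t -> valid n p Q t -> found (2 * cost n pr t) st'.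
Proof.
move=> ok f0 n0.
pose covered t i k st' := win m n p al Q t -> valid n p Q t ->
  (forall j, j < n -> pr j (t j) <= pr i k) -> t i = k -> found (2 * cost n pr t) st'.
suff [out cov] : out_ok (run (PFor 20 1 (PFor 21 0 try_guess)) st) /\
    forall t i k, i < n -> k < m ->
      covered t i k (run (PFor 20 1 (PFor 21 0 try_guess)) st).
  split=> // t tw tv.
  (* The guess that covers [t]: a voter whose shift in [t] is the most expensive. *)
  have [i _ imax] := arg_maxnP (fun i : 'I_n => pr i (t i)) (isT : xpredT (Ordinal n0)).
  apply: (cov t i (t i)) => // [|j ltjn].
    exact: leq_ltn_trans (tv i (ltn_ord i)) (Q_lt (ltn_ord i) ltpm).
  exact: (imax (Ordinal ltjn)).
pose I l (st' : state) :=
  out_ok st' /\ forall t i k, i < l -> k < m -> covered t i k st'.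
apply: (for_rule (I := I)) (in_n ok) _ _ => //.
  by split=> //; rewrite /out_ok /update /= f0.
move=> i st1 ltin iE F [out1 cov1].
have ok1 : tables_ok st1 by apply: tables_ok_eq ok; exact: F.
pose J l (st' : state) := out_ok st' /\
  forall t i' k, i' < i \/ i' = i /\ k < l -> k < m -> covered t i' k st'.
have [out2 cov2] : J m (run (PFor 21 0 try_guess) st1).
  apply: (for_rule (I := J)) (in_m ok1) _ _ => //.
    by split=> // t i' k [lti|[_ //]] ltkm; exact: cov1.
  move=> k st2 ltkm kE F2 [out2 cov2].
  have ok2 : tables_ok st2 by apply: tables_ok_eq ok1; exact: F2.
  have iE2 : st2 20 0 = i by rewrite F2.
  have [out3 mono new] := run_try_guess ok2 iE2 kE ltin out2.
  split=> // t i' k' seen ltk'm tw tv tb tk.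
  case: (boolP ((i' == i) && (k' == k))) => [/andP[/eqP i'E /eqP k'E]|ne].
    by apply: new; rewrite -?i'E -?k'E.
  by apply: mono; apply: (cov2 t i' k') => //; lia.
split=> // t i' k lti' ltkm; apply: cov2 => //; lia.
Qed.

(** * Decoding the input into tables *)

Lemma run_read_positions st : input_ok st ->
  run read_positions st 4 0 = 2 + n * m /\
  forall i, i < n -> run read_positions st 3 i = P i.
Proof.
move=> ok; rewrite run_seq; set st0 := run _ st.
have ok0 : input_ok st0 by apply: input_ok_eq ok.
pose I k (st' : state) := st' 4 0 = 2 + k * m /\ forall i, i < k -> st' 3 i = P i.
apply: (for_rule (I := I)) (in_n ok0) _ _ => // i st1 ltin iE F [o1 P1].
rewrite run_seq; set st2 := run _ st1.
have ok1 : input_ok st1 by apply: input_ok_eq ok0; rewrite F.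
have ok2 : input_ok st2 by apply: input_ok_eq ok1.
have o2 : st2 4 0 = 2 + i.+1 * m.
  by rewrite /st2 /= /update /= (in_m ok1) o1 mulSn; lia.
have iE2 : st2 20 0 = i by rewrite -iE.
have P2 : forall i', i' < i -> st2 3 i' = P i' by exact: P1.
pose J k (st' : state) := [/\ st' 4 0 = 2 + i.+1 * m,
  forall i', i' < i -> st' 3 i' = P i' & P i < k -> st' 3 i = P i].
have [o3 P3 P3i] : J m (run (PFor 21 0 read_candidate) st2).
  apply: (for_rule (I := J)) (in_m ok2) _ _ => // k st3 ltkm kE F3 [o3 P3 P3i].
  have ok3 : input_ok st3 by apply: input_ok_eq ok2; rewrite F3.
  have iE3 : st3 20 0 = i by rewrite F3.
  have -> : run read_candidate st3
    = if st3 1 (3 + (st3 20 0 * st3 1 0 + st3 21 0)) - st3 1 2 != 0 then st3 else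
      if st3 1 2 - st3 1 (3 + (st3 20 0 * st3 1 0 + st3 21 0)) != 0 then st3 else
      update st3 3 (st3 20 0) (st3 21 0) by [].
  rewrite iE3 kE (in_m ok3) (in_p ok3) (in_vt ok3) //.
  have := vtQ ltin ltpm ltkm; case: (vt i k =P p) => [->|ne] kP.
    rewrite !subnn /=; split=> //= [i' lti'|_]; rewrite /update /=.
      by rewrite ltn_eqF // P3.
    by rewrite eqxx; apply/eqP; rewrite -kP.
  have skip : J k.+1 st3.
    split=> //; rewrite ltnS leq_eqVlt => /predU1P[Pk|]; last exact: P3i.
    by rewrite Pk eqxx in kP.
  by case: ifP => // h1; case: ifP => // h2; lia.
split=> // i'; rewrite ltnS leq_eqVlt => /predU1P[->|]; last exact: P3.
by apply: P3i; exact: Q_lt.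
Qed.

Lemma cell_inj i i' k k' : k < m -> k' < m -> i * m + k = i' * m + k' -> i = i' /\ k = k'.
Proof.
move=> ltkm ltk'm e; have m0 : 0 < m by apply: leq_ltn_trans ltkm.
have := congr1 (divn^~ m) e; rewrite !divnMDl // !divn_small // !addn0 => ii.
by split=> //; move: e; rewrite ii => /addnI.
Qed.

Lemma run_read_prices st : input_ok st -> (forall i, i < n -> st 3 i = P i) ->
  st 4 0 = 2 + n * m -> (forall j, st 5 j = 0) ->
  (forall i k, i < n -> 0 < k -> k <= P i ->
     st 1 (2 + n * m + \sum_(i' < i) P i' + k) = pr i k) ->
  tables_ok (run read_prices st).
Proof.
move=> ok P0 o0 z0 prE.
have ok' : input_ok (run read_prices st) by apply: input_ok_eq ok; rewrite run_frame.
split=> //; first by move=> i ltin; rewrite run_frame // P0.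
(* Column 0 of the table is never written; its initial value 0 is the price of the empty shift. *)
pose I l (st' : state) := [/\ st' 4 0 = 2 + n * m + \sum_(i < l) P i,
  forall i, st' 5 (i * m) = 0
  & forall i k, i < l -> 0 < k -> k <= P i -> st' 5 (i * m + k) = pr i k].
suff [_ z H] : I n (run read_prices st).
  move=> i k ltin; case: (posnP k) => [->|k0] kP; last exact: H.
  by rewrite pr0 addn0 z.
apply: (for_rule (I := I)) (in_n ok) _ _ => //.
  by split=> [|i|//]; [rewrite big_ord0 addn0; exact: o0|exact: z0].
move=> i st1 ltin iE F [o1 z1 H1].
have ok1 : input_ok st1 by apply: input_ok_eq ok; rewrite F.
pose J l (st' : state) := (forall i', st' 5 (i' * m) = 0) /\
  forall i' k, i' < i \/ i' = i /\ k < l -> 0 < k -> k <= P i' ->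
     st' 5 (i' * m + k) = pr i' k.
have [z2 H2] : J m (run (PFor 21 0 read_price) st1).
  apply: (for_rule (I := J)) (in_m ok1) _ _ => //.
    by split=> // i' k [|[_ //]]; exact: H1.
  move=> k st2 ltkm kE F2 [z2 H2].
  have ok2 : input_ok st2 by apply: input_ok_eq ok1; rewrite F2.
  have -> : run read_price st2 = if st2 21 0 * (st2 3 (st2 20 0) + 1 - st2 21 0) != 0
    then update st2 5 (st2 20 0 * st2 1 0 + st2 21 0) (st2 1 (st2 4 0 + st2 21 0))
    else st2 by [].
  have iE2 : st2 20 0 = i by rewrite F2.
  have o2 : st2 4 0 = st1 4 0 by rewrite F2.
  have P2 : st2 3 i = P i by rewrite F2 // F // P0.
  have e1 : st2 1 = st 1 by rewrite F2 // F.
  rewrite kE iE2 (in_m ok2) P2 o2 o1 e1.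
  case: ifP => [kin|kout]; last first.
    split=> // i' k' seen k'0 k'P; apply: H2 => //.
    case: seen => [|[e lek]]; [by left|right; split=> //].
    rewrite e in k'P; suff : k' != k by lia.
    apply/eqP => e'; rewrite e' in k'0 k'P.
    by move/negbT: kout; rewrite negbK muln_eq0; lia.
  have [k0 kP] : 0 < k /\ k <= P i.
    by move: kin; rewrite muln_eq0; lia.
  rewrite prE //; split=> [i'|i' k' seen k'0 k'P]; rewrite /update /=.
    case: eqP => [|_]; last exact: z2.
    rewrite -[i' * m]addn0 => /cell_inj[] //; first exact: leq_ltn_trans ltkm.
    by move=> _ k00; rewrite -k00 in k0.
  have ltk'm : k' < m.
    case: seen => [lti'|[_ ltk']]; last exact: leq_trans ltk' ltkm.
    by apply: leq_ltn_trans k'P (Q_lt _ ltpm); exact: ltn_trans ltin.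
  case: eqP => [/cell_inj[]// -> ->|ne] //.
  apply: H2 => //; case: seen => [|[e lek]]; [by left|right; split=> //].
  suff : k' != k by lia.
  by apply/eqP => e'; case: ne; rewrite e e'.
rewrite run_seq.
have [e4 e3 e20] : [/\ run (PFor 21 0 read_price) st1 4 = st1 4,
    run (PFor 21 0 read_price) st1 3 = st 3 & run (PFor 21 0 read_price) st1 20 0 = i].
  by split; rewrite run_frame // F.
move: (run _ st1) z2 H2 e4 e3 e20 => st3 z2 H2 e4 e3 e20; split=> //.
  by rewrite big_ord_recr /= /update /= e4 e3 e20 P0 // o1 addnA.
move=> i' k lti' k0 kP; apply: H2 => //.
have : k < m by apply: leq_ltn_trans kP _; apply: Q_lt => //; lia.
lia.
Qed.

Lemma run_algorithm st : input_ok st -> (forall a j, 1 < a -> st a j = 0) ->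
  (forall i k, i < n -> 0 < k -> k <= P i ->
     st 1 (2 + n * m + \sum_(i' < i) P i' + k) = pr i k) ->
  0 < n ->
  [/\ valid n p Q (run algorithm st 2), win m n p al Q (run algorithm st 2)
    & forall t, win m n p al Q t -> valid n p Q t ->
        cost n pr (run algorithm st 2) <= 2 * cost n pr t].
Proof.
move=> ok z prE n0.
have [o1 P1] := run_read_positions ok.
have F1 : forall a, a \notin writes read_positions -> run read_positions st a = st a.
  by move=> a; exact: run_frame.
have -> : run algorithm st = run (PFor 20 1 (PFor 21 0 try_guess))
            (run read_prices (run read_positions st)) by [].
move: (run read_positions st) o1 P1 F1 => st1 o1 P1 F1.
have ok1 : input_ok st1 by apply: input_ok_eq ok; rewrite F1.
have ok2 : tables_ok (run read_prices st1).
  apply: run_read_prices => //; first by move=> j; rewrite F1 // z.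
  by rewrite F1.
have f0 : run read_prices st1 15 0 = 0 by rewrite run_frame // F1 // z.
have [out all] := run_guesses ok2 f0 n0.
move: (run _ (run _ st1)) out all => st3 out all.
(* Moving [p] to the top everywhere is successful, so something is output. *)
have topw : win m n p al Q (Q^~ p) by exact: win_top.
have [f _] := all _ topw (fun i _ => leqnn _).
have [v w c] := out f; split=> // t tw tv.
by rewrite c; have [] := all t tw tv.
Qed.

End Correctness.

(** * Encoded instances *)

Lemma nth_rem (T : eqType) (x0 p : T) s j : p \in s ->
  nth x0 (rem p s) j = nth x0 s (if j < index p s then j else j.+1).
Proof.
rewrite -index_mem remE => lt; rewrite nth_cat size_take lt.
case: ltnP => le; first by rewrite nth_take.
by rewrite nth_drop; congr nth; lia.
Qed.

Lemma index_shift_seq (T : eqType) (p c : T) k s : uniq s -> p \in s -> c \in s ->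
  index c (shift_seq p k s) = npos (index p s) k (index c s).
Proof.
move=> us ps cs; set q := npos _ _ _.
have perm := perm_shift_seq k ps.
have ltc : index c s < size s by rewrite index_mem.
have ltp : index p s < size s by rewrite index_mem.
have ltq : q < size (shift_seq p k s).
  by rewrite (perm_size perm) /q /npos; repeat case: ifP => ?; lia.
(* Entries are distinct, so it suffices that position [q] holds [c]; the cases are those of
   [npos]. *)
have cE : nth c (shift_seq p k s) q = c; last first.
  by rewrite -{1}cE index_uniq // (perm_uniq perm).
have szr : size (take (index p s - k) (rem p s)) = index p s - k.
  by rewrite size_take size_rem //; case: ifP => //; lia.
rewrite /shift_seq nth_cat szr /q /npos.
case: (ltnP (index c s) (index p s - k)) => [lt1|le1].
  by rewrite lt1 nth_take // nth_rem // ifT ?nth_index //; lia.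
case: (ltnP (index c s) (index p s)) => [lt2|le2].
  rewrite ltnNge leqW //= subSn //= nth_drop subnKC // nth_rem // lt2.
  exact: nth_index.
case: (ltnP (index p s) (index c s)) => [lt3|le3].
  rewrite ltnNge le1 /=; have -> : index c s - (index p s - k) =
     (index c s - (index p s - k)).-1.+1 by lia.
  rewrite /= nth_drop nth_rem //.
  have -> : index p s - k + (index c s - (index p s - k)).-1 = (index c s).-1 by lia.
  by rewrite ifF ?prednK ?nth_index //; lia.
rewrite ltnn subnn /=; have e : index c s = index p s by lia.
by rewrite -(nth_index c ps) -e nth_index.
Qed.

Lemma pos_lt m (v : vote m) c : pos v c < m.
Proof.
by rewrite /pos -[m in _ < m]size_enum_ord -(perm_size (rankingP v)) index_mem
  (perm_mem (rankingP v)) mem_enum.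
Qed.

Lemma pos_shift_vote m (p c : 'I_m) k (v : vote m) :
  pos (shift_vote p k v) c = npos (pos v p) k (pos v c).
Proof.
apply: index_shift_seq; first by rewrite (perm_uniq (rankingP v)) enum_uniq.
  by rewrite (perm_mem (rankingP v)) mem_enum.
by rewrite (perm_mem (rankingP v)) mem_enum.
Qed.

Lemma nth_flatten_index (T : Type) (x0 : T) ss i j : j < size (nth [::] ss i) ->
  nth x0 (flatten ss) (sumn (take i (shape ss)) + j) = nth x0 (nth [::] ss i) j.
Proof.
move=> lt; have lt' : j < nth 0 (shape ss) i.
  rewrite (nth_map [::]) // ltnNge; apply: contraTN lt => le.
  by rewrite nth_default.
by rewrite nth_flatten flatten_indexKl // flatten_indexKr.
Qed.

Lemma sumn_take_ord n (f : nat -> nat) i : i <= n ->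
  sumn (take i [seq f (val j) | j : 'I_n]) = \sum_(j < i) f j.
Proof.
move=> le; rewrite /image_mem (map_comp f val) val_enum_ord -map_take take_iota.
by rewrite (minn_idPl le) sumnE big_map -{1}[i]subn0 big_mkord.
Qed.

Lemma nth_image n (T : Type) (x0 : T) (F : 'I_n -> T) (i : 'I_n) :
  nth x0 [seq F j | j : 'I_n] i = F i.
Proof. by rewrite (nth_map i) ?size_enum_ord // nth_ord_enum. Qed.

Section Encoding.

Variables (m n : nat) (I : instance m n).

(** This and the next two functions read the raw encoding, so that the initial state meets
    [input_ok] by computation; they are then identified with the data of [I]. *)
Definition mem_vote i j := nth 0 (encode_instance I) (3 + (i * m + j)).

Definition mem_pos i c := index c (mkseq (mem_vote i) m).

Definition mem_price i k :=
  if k is k'.+1 then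
    nth 0 (encode_instance I)
        (2 + n * m + \sum_(i' < i) mem_pos i' (designated I) + k)
  else 0.

Lemma size_ranking (i : 'I_n) : size (ranking (tnth (votes I) i)) = m.
Proof. by rewrite (perm_size (rankingP _)) size_enum_ord. Qed.

Lemma shape_votes :
  shape [seq map val (ranking (tnth (votes I) i)) | i : 'I_n] = nseq n m.
Proof.
apply: (@eq_from_nth _ 0) => [|i].
  by rewrite size_map size_image card_ord size_nseq.
rewrite size_map size_image card_ord => lti; rewrite nth_nseq lti.
rewrite (nth_map [::]) ?size_image ?card_ord //.
by rewrite (nth_image _ _ (Ordinal lti)) size_map size_ranking.
Qed.

Lemma mem_voteE (i : 'I_n) j : j < m ->
  mem_vote i j = nth 0 (map val (ranking (tnth (votes I) i))) j.
Proof.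
move=> ltjm; rewrite /mem_vote /encode_instance /= nth_cat size_flatten shape_votes.
rewrite sumn_nseq ifT; last by have := ltn_ord i; nia.
have -> : i * m = sumn (take i (nseq n m)).
  by rewrite take_nseq ?sumn_nseq; [exact: mulnC|exact: ltnW].
rewrite add0n -shape_votes nth_flatten_index nth_image //.
by rewrite size_map size_ranking.
Qed.

Lemma mem_posE (i : 'I_n) (c : 'I_m) : mem_pos i c = pos (tnth (votes I) i) c.
Proof.
rewrite /mem_pos; have -> : mkseq (mem_vote i) m = map val (ranking (tnth (votes I) i)).
  apply: (@eq_from_nth _ 0) => [|j]; first by rewrite size_mkseq size_map size_ranking.
  by rewrite size_mkseq => ltj; rewrite nth_mkseq // mem_voteE.
by rewrite index_map //; exact: val_inj.
Qed.

Lemma mem_priceE (i : 'I_n) k : k <= pos (tnth (votes I) i) (designated I) ->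
  mem_price i k = price I i k.
Proof.
case: k => [|k] ltk; first by rewrite price0.
rewrite /mem_price; have -> : 2 + n * m + \sum_(i' < i) mem_pos i' (designated I) + k.+1
  = 3 + (n * m + (\sum_(i' < i) mem_pos i' (designated I) + k)) by lia.
rewrite /encode_instance /= add0n nth_cat size_flatten shape_votes sumn_nseq.
rewrite [m * n]mulnC ltnNge leq_addr /= addKn.
set ss := [seq [seq _ | _ <- _] | _ : _].
have sh : shape ss = [seq mem_pos (val j) (designated I) | j : 'I_n].
  rewrite /shape /ss /image_mem -map_comp; apply: eq_map => j /=.
  by rewrite size_map size_iota mem_posE.
have nthss : nth [::] ss i =
  [seq price I i k | k <- iota 1 (pos (tnth (votes I) i) (designated I))].
  exact: nth_image.
rewrite -(sumn_take_ord (mem_pos^~ (designated I)) (ltnW (ltn_ord i))) -sh.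
rewrite nth_flatten_index nthss ?size_map ?size_iota //.
by rewrite (nth_map 0) ?size_iota // nth_iota.
Qed.

End Encoding.

(** * The program on an encoded instance *)

Section Instance.

Variables (m n : nat) (alpha : scoring_vector m) (I : instance m n).

Let mem0 := initial_state [:: encode_scoring alpha; encode_instance I].

Lemma input_ok_initial :
  input_ok m n (designated I) (nth 0 alpha) (mem_vote I) mem0.
Proof. by []. Qed.

Lemma score_shf (t : shift_action n) (c : 'I_m) :
  score alpha (shf (designated I) (votes I) t) c
  = sc n (designated I) (nth 0 alpha) (mem_pos I) (nth 0 t) c.
Proof.
apply: eq_bigr => i _; rewrite tnth_mktuple pos_shift_vote !mem_posE.
by rewrite (tnth_nth 0).
Qed.

Lemma successfulP (t : shift_action n) :
  successful (scoring_rule alpha) I t <->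
  win m n (designated I) (nth 0 alpha) (mem_pos I) (nth 0 t).
Proof.
rewrite /successful inE; split=> [/forallP H c ltcm|H].
  by have := H (Ordinal ltcm); rewrite !score_shf.
by apply/forallP => c; rewrite !score_shf; apply: H.
Qed.

Lemma mem_posP i c j : i < n -> c < m -> j < m ->
  (mem_vote I i j == c) = (j == mem_pos I i c).
Proof.
move=> lti ltc ltj; rewrite -[i]/(val (Ordinal lti)) -[c]/(val (Ordinal ltc)).
rewrite mem_posE mem_voteE // (nth_map (Ordinal ltc)) ?size_ranking //.
set v := tnth _ _; rewrite val_eqE /pos.
have uv : uniq v by rewrite (perm_uniq (rankingP v)) enum_uniq.
rewrite -(nth_uniq (Ordinal ltc) _ _ uv) ?size_ranking ?nth_index //.
- by rewrite (perm_mem (rankingP v)) mem_enum.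
- by have := pos_lt v (Ordinal ltc).
Qed.

Lemma mem_pos_lt i c : i < n -> c < m -> mem_pos I i c < m.
Proof.
move=> lti ltc; rewrite -[i]/(val (Ordinal lti)) -[c]/(val (Ordinal ltc)).
by rewrite mem_posE pos_lt.
Qed.

Lemma points_anti i j : i <= j -> nth 0 alpha j <= nth 0 alpha i.
Proof.
move=> le; case: (ltnP j m) => lt; last by rewrite nth_default ?size_tuple.
have tr : transitive geq by move=> x y z /= h1 h2; exact: leq_trans h2 h1.
apply: (sorted_leq_nth tr leqnn 0 (points_sorted alpha)) => //;
  by rewrite inE size_tuple //; exact: leq_ltn_trans lt.
Qed.

Lemma price_mono (i : 'I_n) k l : k <= l -> price I i k <= price I i l.
Proof. by move=> kl; apply: (homo_leq leqnn leq_trans (price_le I i)). Qed.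

Lemma mem_price_mono i k l : i < n -> k <= l -> l <= mem_pos I i (designated I) ->
  mem_price I i k <= mem_price I i l.
Proof.
move=> lti; rewrite -[i]/(val (Ordinal lti)) mem_posE => le lP.
by rewrite !mem_priceE ?price_mono //; exact: leq_trans lP.
Qed.

(** Prices are constant beyond the top, so capped shifts, whose prices are encoded, determine the
    cost. *)
Lemma shift_costE (t : shift_action n) :
  shift_cost I t = cost n (mem_price I)
    (fun i => minn (nth 0 t i) (mem_pos I i (designated I))).
Proof.
apply: eq_bigr => i _; rewrite mem_posE mem_priceE ?geq_minr // (tnth_nth 0).
by case: leqP => // lt; rewrite price_const.
Qed.

(** Rules out the dummy value of [opt]. *)
Lemma optP (t : shift_action n) : successful (scoring_rule alpha) I t ->
  exists2 t0, successful (scoring_rule alpha) I t0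
            & shift_cost I t0 = opt (scoring_rule alpha) I.
Proof.
move=> succ; rewrite /opt; case: pselect => [ex|[]]; last first.
  by exists (shift_cost I t); apply/asboolP; exists t.
by case: ex_minnP => k /asboolP[t0 [? ?]] _; exists t0.
Qed.

Lemma run_algorithm_optimal : 0 < n ->
  let t := read_array (run algorithm mem0) 2 n in
  successful (scoring_rule alpha) I t /\
  shift_cost I t <= 2 * opt (scoring_rule alpha) I.
Proof.
move=> n0 t.
have [||v w best] := run_algorithm (ltn_ord _) mem_posP mem_pos_lt points_anti
  mem_price_mono (fun i => erefl) input_ok_initial _ _ n0.
- by case=> [|[|a]] // j _; rewrite /mem0 /initial_state /= !nth_nil.
- by move=> i [].
have tE i : i < n -> nth 0 t i = run algorithm mem0 2 i.
  by move=> lti; rewrite -(tnth_nth 0 t (Ordinal lti)) tnth_mktuple.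
have succ : successful (scoring_rule alpha) I t.
  by apply/successfulP => c ltc; rewrite !(eq_sc _ _ _ _ tE); apply: w.
split=> //; have [t0 succ0 <-] := optP succ.
(* An optimal action may overshoot the top; capping it changes neither scores nor cost. *)
set s0 := fun i => minn (nth 0 t0 i) (mem_pos I i (designated I)).
apply: leq_trans (_ : _ <= 2 * cost n (mem_price I) s0) _; last first.
  by rewrite -shift_costE.
have -> : shift_cost I t = cost n (mem_price I) (run algorithm mem0 2).
  rewrite shift_costE; apply: eq_bigr => i _; congr mem_price.
  by rewrite tE //; apply/minn_idPl; apply: v.
apply: best; last by move=> i _; exact: geq_minr.
have scE c : sc n (designated I) (nth 0 alpha) (mem_pos I) s0 c
    = sc n (designated I) (nth 0 alpha) (mem_pos I) (nth 0 t0) c.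
  by apply: eq_bigr => i _; rewrite /s0 -nposW.
have /successfulP w0 := succ0.
by move=> c ltc; rewrite !scE; exact: w0.
Qed.

End Instance.

(** * Input size and the final time bound *)

Lemma size_le_bitsize s : size s <= bitsize s.
Proof. by rewrite /bitsize -sum1_size leq_sum. Qed.

Lemma nth_lt_bitsize s i : nth 0 s i < 2 ^ bitsize s.
Proof.
case: (ltnP i (size s)) => [lt|le]; last by rewrite nth_default // expn_gt0.
apply: leq_trans (ltn_bits _) _; rewrite leq_exp2l //.
by rewrite /bitsize (big_rem _ (mem_nth 0 lt)) leq_addr.
Qed.

Theorem theorem3p1 :
  exists (B : cmd) (c d : nat),
  forall (m n : nat) (alpha : scoring_vector m) (I : instance m n),
  exists (st : state) (T : nat) (t : shift_action n),
    [/\ exec B (initial_state [:: encode_scoring alpha; encode_instance I])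
             st T,
        t = read_array st 2 n,
        successful (scoring_rule alpha) I t,
        shift_cost I t <= 2 * opt (scoring_rule alpha) I
      & T <= c * (bitsize (encode_instance I)
                  + bitsize (encode_scoring alpha)) ^ d + c].
Proof.
have [C [D weightE]] := weight_poly algorithm.
(* The time is at most [W * (N + W)] with [W <= C * N.+1 ^ D] and [N + W <= C.+1 * N.+1 ^ D.+1]; the
   exponents double because [N.+1 <= N ^ 2]. *)
exists (compile algorithm), (C * C.+1), (2 * D.+1 + 2 * D) => m n alpha I.
set mem0 := initial_state _; set N := bitsize _ + bitsize _.
have m0 : 0 < m by apply: leq_ltn_trans (ltn_ord (designated I)).
have mN : m <= N.
  apply: leq_trans (leq_addl _ _).
  have : size alpha <= bitsize alpha := size_le_bitsize alpha.
  by rewrite size_tuple.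
have [nN N3] : n <= N /\ 3 <= N.
  suff : n * m + 3 <= N by nia.
  apply: leq_trans (leq_addr _ _); apply: leq_trans (size_le_bitsize _).
  rewrite /encode_instance /= size_cat size_flatten shape_votes sumn_nseq; lia.
have memB : bounded N mem0.
  case=> [|[|a]] i; rewrite /mem0 /initial_state /=.
  - by apply: leq_trans (nth_lt_bitsize _ _) _; rewrite leq_exp2l // leq_addl.
  - by apply: leq_trans (nth_lt_bitsize _ _) _; rewrite leq_exp2l // leq_addr.
  - by rewrite !nth_nil expn_gt0.
have [_ [T ex Tle]] := exec_compile wf_algorithm mN nN memB.
exists (run algorithm mem0), T, (read_array (run algorithm mem0) 2 n).
have [succ cost] :
  successful (scoring_rule alpha) I (read_array (run algorithm mem0) 2 n) /\
  shift_cost I (read_array (run algorithm mem0) 2 n) <= 2 * opt (scoring_rule alpha) I.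
  (* Without voters no guess is tried, but all scores and costs are 0. *)
  case: (posnP n) => [n0|]; last exact: run_algorithm_optimal.
  have none (i : 'I_n) : False by have := ltn_ord i; rewrite [X in _ < X]n0.
  split; last by rewrite /shift_cost big1 // => i; case: (none i).
  rewrite /successful inE; apply/forallP => c.
  by rewrite /score big1 // => i; case: (none i).
split=> //; apply: leq_trans Tle _; apply: leq_trans (leq_addr _ _).
set W := weight N algorithm in weightE *.
have WE : W <= C * N.+1 ^ D := weightE N.
have N2 : N.+1 <= N ^ 2 by nia.
have NW : N + W <= C.+1 * N.+1 ^ D.+1.
  have : 0 < N.+1 ^ D by rewrite expn_gt0.
  by move: WE; rewrite expnS; move: (_ ^ D) => y; nia.
apply: leq_trans (leq_mul WE NW) _.
rewrite mulnACA leq_mul2l -expnD addnC; apply/orP; right.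
by rewrite -mulnDr expnM leq_exp2r //; lia.
Qed.
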